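(* Let $\gamma>2$ and suppose that there are constants $c_0>\tilde c_0>0$ and $c_1>0$ such that for all $(x,t)\in Q_T$ $$\tilde c_0\, d^{\gamma}(x)\le a(x,t)\le c_0\, d^{\gamma}(x)\quad\text{and}\quad |\nabla a(x,t)|\le c_1\, d^{\gamma-1}(x).$$ Let $u\in C^{2,1}(Q_T)\cap C(\Omega\times[0,T])$ satisfy $\partial_t u=\operatorname{div}\{a(x,t)\nabla u\}$ in $Q_T$ and $u=0$ on $\Omega\times\{0\}$. Suppose moreover that, for some $C>0$, $\theta>0$, $\varepsilon_0>0$, $$\int_0^T\int_{\Omega^{\varepsilon}}|u(x,t)|\,dx\,dt\le C e^{\theta\,\varepsilon^{-\gamma+2}}\qquad\text{for every }\varepsilon\in(0,\varepsilon_0).$$ Then $u\equiv 0$ in $Q_T$.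
   Context: $\Omega\subset\mathbb{R}^n$ is an open bounded set whose boundary $\partial\Omega$ is a manifold of dimension $n-1$ of class $C^3$; $T>0$; $Q_T:=\Omega\times(0,T]$. The coefficient $a$ satisfies $a\in C^{1,0}_{x,t}(Q_T)$ ($C^1$ in $x$, continuous in $t$), $a\ge 0$, $a\not\equiv0$ in $Q_T$. $\nabla$ and $\operatorname{div}$ are taken with respect to $x$. $d(x):=\operatorname{dist}(x,\partial\Omega)$ for $x\in\Omega$, and $\Omega^{\varepsilon}:=\{x\in\Omega: d(x)>\varepsilon\}$ for $\varepsilon>0$. No boundary conditions are imposed on $\partial\Omega\times(0,T]$. *)

(* Defs.v *)
From HB Require Import structures.
From mathcomp Require Import all_boot all_order all_algebra.
From mathcomp Require Import all_classical all_reals all_analysis.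
Import Order.TTheory GRing.Theory Num.Theory.
Import numFieldNormedType.Exports.

Set Implicit Arguments.
Unset Strict Implicit.
Unset Printing Implicit Defensive.

Local Open Scope classical_set_scope.
Local Open Scope ring_scope.

(* The library norm on ['rV[R]_n] is the sup norm; it induces the usual topology
    and bounded sets, but lengths and distances have to be Euclidean. *)

Definition enorm (R : realType) n (v : 'rV[R]_n) : R :=
  Num.sqrt (\sum_(i < n) v ord0 i ^+ 2).

Definition boundary (T : topologicalType) (A : set T) : set T :=
  closure A `\` interior A.

Definition bdist (R : realType) n (Omega : set 'rV[R]_n) (x : 'rV[R]_n) : R :=
  inf [set enorm (x - y) | y in boundary Omega].

Definition inner_set (R : realType) n (Omega : set 'rV[R]_n) (eps : R) :
    set 'rV[R]_n :=
  [set x | Omega x /\ eps < bdist Omega x].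

Definition basis_vec (R : realType) n (i : 'I_n) : 'rV[R]_n := delta_mx ord0 i.

(* Only meaningful for [U] open. *)
Fixpoint Ck_on (R : realType) n (k : nat) (U : set 'rV[R]_n)
    (f : 'rV[R]_n -> R) : Prop :=
  (forall x, U x -> {for x, continuous f}) /\
  match k with
  | 0%N => True
  | k'.+1 => forall i : 'I_n,
      (forall x, U x -> derivable f x (basis_vec R i)) /\
      Ck_on k' U ('D_(basis_vec R i) f)
  end.

Definition Ck_map_on (R : realType) n m (k : nat) (U : set 'rV[R]_n)
    (F : 'rV[R]_n -> 'rV[R]_m) : Prop :=
  forall j : 'I_m, Ck_on k U (fun x => F x ord0 j).

(* [R^m x {0}] inside [R^n] *)
Definition coord_slice (R : realType) n (m : nat) : set 'rV[R]_n :=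
  [set y | forall i : 'I_n, (m <= i)%N -> y ord0 i = 0].

Definition Ck_diffeo (R : realType) n (k : nat) (U V : set 'rV[R]_n)
    (Phi Psi : 'rV[R]_n -> 'rV[R]_n) : Prop :=
  [/\ Ck_map_on k U Phi, Ck_map_on k V Psi, Phi @` U = V &
      forall x, U x -> Psi (Phi x) = x].

(* [M] is an [m]-dimensional submanifold of class [C^k], without boundary, of
   [R^n]: around each of its points it is straightened by a local diffeomorphism. *)
Definition Ck_submanifold (R : realType) n (k m : nat) (M : set 'rV[R]_n) : Prop :=
  forall p, M p ->
    exists (U V : set 'rV[R]_n) (Phi Psi : 'rV[R]_n -> 'rV[R]_n),
      [/\ open U, U p, open V, Ck_diffeo k U V Phi Psi &
          Phi @` (M `&` U) = V `&` @coord_slice R n m].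

Definition cylinder (R : realType) n (Omega : set 'rV[R]_n) (T : R) :
    set ('rV[R]_n * R) :=
  [set p | Omega p.1 /\ 0 < p.2 <= T].

Definition closed_cylinder (R : realType) n (Omega : set 'rV[R]_n) (T : R) :
    set ('rV[R]_n * R) :=
  [set p | Omega p.1 /\ 0 <= p.2 <= T].

Definition x_derivable (R : realType) n (f : 'rV[R]_n * R -> R) (i : 'I_n)
    (p : 'rV[R]_n * R) : Prop :=
  derivable (fun y => f (y, p.2)) p.1 (basis_vec R i).

Definition dx (R : realType) n (i : 'I_n) (f : 'rV[R]_n * R -> R)
    (p : 'rV[R]_n * R) : R :=
  'D_(basis_vec R i) (fun y => f (y, p.2)) p.1.

(* Time derivatives are relative to the interval (0, T]: two-sided for t < T and
   from the left at t = T, so that values outside the cylinder play no role. *)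
Definition dt_filter (R : realType) (T t : R) : set_system R :=
  within [set h | 0 < t + h <= T] 0^'.

Definition t_quotient (R : realType) n (f : 'rV[R]_n * R -> R)
    (p : 'rV[R]_n * R) (h : R) : R :=
  h^-1 * (f (p.1, p.2 + h) - f p).

Definition t_derivable (R : realType) n (T : R) (f : 'rV[R]_n * R -> R)
    (p : 'rV[R]_n * R) : Prop :=
  cvg (t_quotient f p @ dt_filter T p.2).

Definition dt (R : realType) n (T : R) (f : 'rV[R]_n * R -> R)
    (p : 'rV[R]_n * R) : R :=
  lim (t_quotient f p @ dt_filter T p.2).

Definition grad (R : realType) n (f : 'rV[R]_n * R -> R) (p : 'rV[R]_n * R) :
    'rV[R]_n :=
  \row_(i < n) dx i f p.

Definition divergence (R : realType) n (F : 'rV[R]_n * R -> 'rV[R]_n)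
    (p : 'rV[R]_n * R) : R :=
  \sum_(i < n) dx i (fun q => F q ord0 i) p.

Definition C10 (R : realType) n (Omega : set 'rV[R]_n) (T : R)
    (f : 'rV[R]_n * R -> R) : Prop :=
  {within cylinder Omega T, continuous f} /\
  forall i : 'I_n,
    (forall p, cylinder Omega T p -> x_derivable f i p) /\
    {within cylinder Omega T, continuous (dx i f)}.

Definition C21 (R : realType) n (Omega : set 'rV[R]_n) (T : R)
    (f : 'rV[R]_n * R -> R) : Prop :=
  [/\ C10 Omega T f,
      forall i : 'I_n, C10 Omega T (dx i f),
      forall p, cylinder Omega T p -> t_derivable T f p &
      {within cylinder Omega T, continuous (dt T f)}].

(* Lebesgue measure on R^n is built on [n.-tuple R], which carries the product sigma-algebra, as the
    [n]-fold product of the one-dimensional Lebesgue measure. *)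

Section leb_step.
Context (R : realType) (n : nat).
Local Notation RT := (measurableTypeR R).
Variable mu : {sigma_finite_measure set (n.-tuple RT) -> \bar R}.

Definition tcons (p : RT * n.-tuple RT) : n.+1.-tuple RT := [tuple of p.1 :: p.2].

Lemma measurable_tcons : measurable_fun setT tcons.
Proof.
exact: (measurable_cons (@measurable_fst _ _ RT (n.-tuple RT)) measurable_snd).
Qed.

Definition leb_step : set (n.+1.-tuple RT) -> \bar R :=
  pushforward (product_measure1 (@lebesgue_measure R) mu) tcons.

Let leb_step0 : leb_step set0 = 0%E.
Proof.
exact: (measure0 (product_measure1 (@lebesgue_measure R) mu)).
Qed.

Let leb_step_ge0 A : (0 <= leb_step A)%E.
Proof.
exact: (measure_ge0 (product_measure1 (@lebesgue_measure R) mu) (tcons @^-1` A)).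
Qed.

Let leb_step_sigma_additive : semi_sigma_additive leb_step.
Proof.
have mt := measurable_tcons.
move=> F mF tF mUF; rewrite /leb_step /pushforward preimage_bigcup.
apply: measure_semi_sigma_additive.
- by move=> k; rewrite -[X in measurable X]setTI; exact: mt.
- apply/trivIsetP => /= i j _ _ ij; rewrite -preimage_setI.
  by move/trivIsetP : tF => /(_ _ _ _ _ ij) ->//; rewrite preimage_set0.
- by rewrite -preimage_bigcup -[X in measurable X]setTI; exact: mt.
Qed.

HB.instance Definition _ := isMeasure.Build _ _ _ leb_step
  leb_step0 leb_step_ge0 leb_step_sigma_additive.

Let leb_step_sigma_finite : sigma_finite setT leb_step.
Proof.
have /sigma_finiteP[F [TF ndF Foo]] := sigma_finiteT (@lebesgue_measure R).
have /sigma_finiteP[G [TG ndG Goo]] := sigma_finiteT mu.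
pose g (t : n.+1.-tuple RT) : RT * n.-tuple RT :=
  (tnth t ord0, [tuple of behead t]).
have mg : measurable_fun setT g.
  apply/measurable_fun_pairP; split.
    exact: measurable_tnth.
  exact: measurable_behead.
have gK : g \o tcons = id.
  by apply/funext => -[x t]; congr pair; apply/val_inj.
have FGT : \bigcup_k (F k `*` G k) = setT.
  rewrite -subTset => -[x y] _.
  have [k _ Fkx] : (\bigcup_k F k) x by rewrite -TF.
  have [l _ Gly] : (\bigcup_k G k) y by rewrite -TG.
  exists (maxn k l) => //; split => /=.
  - by move: x Fkx; exact/subsetPset/ndF/leq_maxl.
  - by move: y Gly; exact/subsetPset/ndG/leq_maxr.
exists (fun k => g @^-1` (F k `*` G k)); first by rewrite -preimage_bigcup FGT.
move=> k; have [mFk Fkoo] := Foo k; have [mGk Gkoo] := Goo k; split.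
  by rewrite -[X in measurable X]setTI; apply: mg => //; exact: measurableX.
rewrite /leb_step /pushforward -comp_preimage gK preimage_id.
by rewrite product_measure1E// lte_mul_pinfty// ge0_fin_numE.
Qed.

HB.instance Definition _ := Measure_isSigmaFinite.Build _ _ _ leb_step
  leb_step_sigma_finite.

End leb_step.

Fixpoint leb (R : realType) (n : nat) :
    {sigma_finite_measure set (n.-tuple (measurableTypeR R)) -> \bar R} :=
  match n with
  | 0%N => @dirac _ (0.-tuple (measurableTypeR R)) [tuple] R
  | n'.+1 => leb_step (leb R n')
  end.

Definition rV_of_tuple (R : realType) n (y : n.-tuple (measurableTypeR R)) :
    'rV[R]_n :=
  \row_(i < n) tnth y i.

Definition integral_rV (R : realType) n (A : set 'rV[R]_n)
    (f : 'rV[R]_n -> \bar R) : \bar R :=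
  (\int[leb R n]_(y in @rV_of_tuple R n @^-1` A) f (rV_of_tuple y))%E.

(* Main.v *)
Require Import Defs.
From mathcomp Require Import all_boot all_order all_algebra.
From mathcomp Require Import all_classical all_reals all_analysis.
From mathcomp Require Import measurable_realfun ring lra.
Import Order.TTheory GRing.Theory Num.Theory.
Import numFieldNormedType.Exports.
Local Open Scope classical_set_scope.
Local Open Scope ring_scope.

(** Write [d] for the distance to the boundary. The growth allowed for [u] near the
    boundary is beaten by an explicit weight which decays there like
    exp (- al d^(2 - gamma) / (S - t)); this works on short time intervals
    [t0, t0 + delta / 2], with S = t0 + delta, and the theorem follows by iteration.

    The weight. For a boundary point y put q(x) = |x - y|^2, m = 1 - gamma / 2 < 0 and
    e(x, t) = exp (al q(x)^m / (S - t)). As d(x) <= |x - y|, the upper bounds on [a] and on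
    its gradient control every term of the operator d/dt + div (a grad) applied to 1/e, and
    1/e is a supersolution when al and delta are small. Let W be the sum of the e over a
    finite net of boundary points of mesh eps. The harmonic sum 1/W is again a
    supersolution, because it is a concave increasing function of the 1/e; in terms of W
    this is an application of the Cauchy-Schwarz inequality ([barrier_supersol]). Points of
    the boundary rather than d itself enter in the formula, so that W is smooth in Omega;
    still W is at least K = exp ((theta + 1) eps^(2 - gamma)) where d < 2 eps.

    The test function. phi = (K - W)_+^3 / (W K^3) is a convex truncation of 1/W which
    vanishes for d < 2 eps. The truncation only costs an error of size eps^(2 - gamma) / K
    in the differential inequality ([test_fun_supersol]).

    The energy. With the convex function beta(s) = sqrt (1 + s^2) - 1 in the role of the
    absolute value, integrations by parts give Kato's inequality
    d/dt int beta(u) phi <= int beta(u) (phi_t + div (a grad phi)) ([energy_ineq]). Start from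
    u = 0 at time t0, integrate in time and insert the growth hypothesis: with
    X = eps^(2 - gamma), the integral of beta(u) phi at time tau is at most a constant times
    exp (theta X) X / K = X exp (- X) ([energy_decay]).

    Conclusion. If u(tau) does not vanish identically, the same integral is at least a
    constant divided by the number of points of the net, which is O(eps^(- n)), a power of X.
    Letting X tend to infinity gives a contradiction ([uniqueness_step]). *)

(** * Continuity at a point and directional derivatives *)

Section pointwise_continuity.
Context {R : realType} {T : topologicalType}.
Implicit Types (f g : T -> R) (x : T).

Lemma cont_cst (c : R) x : {for x, continuous (fun _ : T => c)}.
Proof. exact: cst_continuous. Qed.

Lemma contD f g x : {for x, continuous f} -> {for x, continuous g} ->
  {for x, continuous (fun z => f z + g z)}.
Proof. exact: cvgD. Qed.

Lemma contB f g x : {for x, continuous f} -> {for x, continuous g} ->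
  {for x, continuous (fun z => f z - g z)}.
Proof. exact: cvgB. Qed.

Lemma contM f g x : {for x, continuous f} -> {for x, continuous g} ->
  {for x, continuous (fun z => f z * g z)}.
Proof. exact: cvgM. Qed.

Lemma contX f k x : {for x, continuous f} -> {for x, continuous (fun z => f z ^+ k)}.
Proof.
move=> cf; apply: (@continuous_comp _ _ _ f (fun s => s ^+ k)) => //.
exact: exprn_continuous.
Qed.

Lemma contV f x : f x != 0 -> {for x, continuous f} ->
  {for x, continuous (fun z => (f z)^-1)}.
Proof. by move=> f0 cf; apply: cvgV. Qed.

Lemma cont_comp (h : R -> R) f x : {for f x, continuous h} -> {for x, continuous f} ->
  {for x, continuous (fun z => h (f z))}.
Proof. by move=> ch cf; exact: continuous_comp. Qed.

Lemma cont_max f g x : {for x, continuous f} -> {for x, continuous g} ->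
  {for x, continuous (fun z => Num.max (f z) (g z))}.
Proof. exact: continuous_max. Qed.

Lemma cont_min f g x : {for x, continuous f} -> {for x, continuous g} ->
  {for x, continuous (fun z => Num.min (f z) (g z))}.
Proof. exact: continuous_min. Qed.

Lemma cont_sum (I : Type) (r : seq I) (f : I -> T -> R) x :
  (forall i, {for x, continuous (f i)}) ->
  {for x, continuous (fun z => \sum_(i <- r) f i z)}.
Proof.
move=> cf; elim: r => [|i r IH].
  rewrite (_ : (fun _ => _) = cst 0); last by apply/funext => z; rewrite big_nil.
  exact: cst_continuous.
rewrite (_ : (fun _ => _) = fun z => f i z + \sum_(j <- r) f j z).
  by apply: contD; [exact: cf|exact: IH].
by apply/funext => z; rewrite big_cons.
Qed.

End pointwise_continuity.

Lemma cont_pair {S T U : topologicalType} (f : S -> T) (g : S -> U) x :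
  {for x, continuous f} -> {for x, continuous g} ->
  {for x, continuous (fun x => (f x, g x))}.
Proof.
move=> cf cg.
exact: (@cvg_pair _ _ _ (nbhs x) (nbhs (f x)) (nbhs (g x)) _ _ _ f g cf cg).
Qed.

Lemma cont_id {T : topologicalType} (x : T) : {for x, continuous (fun z => z)}.
Proof. exact: cvg_id. Qed.

Section directional_derivatives.
Context {R : realType} {V : normedModType R}.
Implicit Types (f g : V -> R) (x v : V).

Lemma dir_cst (c : R) x v : is_derive x v (fun _ : V => c) 0.
Proof. exact: is_derive_cst. Qed.

Lemma dirD f g x v df dg : is_derive x v f df -> is_derive x v g dg ->
  is_derive x v (fun z => f z + g z) (df + dg).
Proof. by move=> ? ?; exact: is_deriveD. Qed.

Lemma dirB f g x v df dg : is_derive x v f df -> is_derive x v g dg ->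
  is_derive x v (fun z => f z - g z) (df - dg).
Proof. by move=> ? ?; exact: is_deriveB. Qed.

Lemma dirM f g x v df dg : is_derive x v f df -> is_derive x v g dg ->
  is_derive x v (fun z => f z * g z) (df * g x + f x * dg).
Proof.
move=> df' dg'; have := @is_deriveM R V f g x v df dg df' dg'.
rewrite [X in is_derive _ _ _ X](_ : _ = df * g x + f x * dg)//.
by rewrite /GRing.scale /= addrC [g x * _]mulrC.
Qed.

Lemma dirX f (k : nat) x v df : is_derive x v f df ->
  is_derive x v (fun z => f z ^+ k.+1) (k.+1%:R * f x ^+ k * df).
Proof.
move=> df'; have := @is_deriveX R V f k.+1 x v df df'.
by rewrite exprfctE.
Qed.

(** Differentiating along a line reduces statements on directional derivatives, such as the
    chain rule, to functions of one real variable. *)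
Lemma is_derive_line f x v s df :
  is_derive (s *: v + x) v f df <-> is_derive s 1 (fun s => f (s *: v + x)) df.
Proof.
have E : (fun h => h^-1 *: (f (h *: v + (s *: v + x)) - f (s *: v + x))) =
  (fun h : R => h^-1 *: ((fun s => f (s *: v + x)) (h *: 1 + s) -
      (fun s => f (s *: v + x)) s)).
  by apply/funext => h /=; rewrite addrA -scalerDl /GRing.scale /= mulr1.
split=> -[h1 h2]; split.
- by rewrite /derivable -E.
- by rewrite /derive -E.
- by rewrite /derivable E.
- by rewrite /derive E.
Qed.

Lemma is_derive_line0 f x v df :
  is_derive x v f df <-> is_derive (0 : R) 1 (fun s : R => f (s *: v + x)) df.
Proof. by rewrite -is_derive_line scale0r add0r. Qed.

Lemma dir_comp (h : R -> R) f x v df dh :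
  is_derive (f x) 1 h dh -> is_derive x v f df ->
  is_derive x v (fun z => h (f z)) (dh * df).
Proof.
move=> dh' df'; apply/is_derive_line0.
have := proj1 (is_derive_line0 f x v df) df'.
move=> dF; apply: (@is_derive1_comp R h (fun s => f (s *: v + x))).
by rewrite /= scale0r add0r.
Qed.

Lemma dirV f x v df : f x != 0 -> is_derive x v f df ->
  is_derive x v (fun z => (f z)^-1) (- (f x) ^- 2 * df).
Proof.
move=> fx df'; apply: (dir_comp GRing.inv f x v df (- (f x) ^- 2)) => //.
have := @is_deriveV R (fun z : R => z) (f x) 1 1 fx (is_derive_id _ _).
by rewrite /GRing.scale /= mulr1.
Qed.

Lemma dir_sum (I : Type) (r : seq I) (f : I -> V -> R) (df : I -> R) x v :
  (forall i, is_derive x v (f i) (df i)) ->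
  is_derive x v (fun z => \sum_(i <- r) f i z) (\sum_(i <- r) df i).
Proof.
move=> cf; elim: r => [|i r IH].
  rewrite big_nil (_ : (fun _ => _) = cst 0); first exact: is_derive_cst.
  by apply/funext => z; rewrite big_nil.
rewrite big_cons (_ : (fun _ => _) = f i + fun z => \sum_(j <- r) f j z).
  exact: is_deriveD.
by apply/funext => z; rewrite big_cons.
Qed.

End directional_derivatives.

(** * Lebesgue measure of boxes and measurability of continuous functions *)

Lemma coord_le_norm {R : realType} {n} (v : 'rV[R]_n) (i : 'I_n) :
  `|v ord0 i| <= `|v|.
Proof.
rewrite [leRHS]/Num.norm /= mx_normrE; apply/bigmax_geP; right => /=.
by exists (ord0, i).
Qed.

Lemma norm_le_coord {R : realType} {n} (v : 'rV[R]_n) (M : R) : 0 <= M ->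
  (forall i, `|v ord0 i| <= M) -> `|v| <= M.
Proof.
move=> M0 vM; rewrite [leLHS]/Num.norm /= mx_normrE.
by apply: bigmax_le => // -[j i] _ /=; rewrite ord1.
Qed.

Lemma continuousP_norm {R : realType} (V W : normedModType R) (f : V -> W) x :
  {for x, continuous f} <-> forall e, 0 < e ->
    exists2 d, 0 < d & forall y, `|y - x| < d -> `|f y - f x| < e.
Proof.
split.
  move=> /cvgrPdist_lt cf e e0; have /cf/nbhs_ballP[d /= d0 h] := e0.
  exists d => // y yd; rewrite distrC; apply: h.
  by rewrite -ball_normE /= distrC.
move=> h; apply/cvgrPdist_lt => e /h[d d0 hd]; apply/nbhs_ballP; exists d => // y.
by rewrite -ball_normE /= distrC => /hd; rewrite distrC.
Qed.

Definition box {R : realType} {n} (x : 'rV[R]_n) (r : R) : set 'rV[R]_n :=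
  [set v | forall i, `|v ord0 i - x ord0 i| <= r].

Lemma boxE {R : realType} {n} (x : 'rV[R]_n) (r : R) : 0 <= r ->
  box x r = [set v | `|v - x| <= r].
Proof.
move=> r0; apply/seteqP; split => v /= vx.
  by apply: norm_le_coord => // i; rewrite !mxE; exact: vx.
move=> i; apply: le_trans vx; have := coord_le_norm (v - x) i.
by rewrite !mxE.
Qed.

Lemma tnth_tcons0 {R : realType} {n} (s : R) (y : n.-tuple (measurableTypeR R)) :
  tnth (tcons (s, y)) ord0 = s.
Proof. by []. Qed.

Lemma tnth_tconsS {R : realType} {n} (s : R) (y : n.-tuple (measurableTypeR R))
  (i : 'I_n) : tnth (tcons (s, y)) (lift ord0 i) = tnth y i.
Proof. by rewrite !(tnth_nth 0). Qed.

Lemma measurable_box {R : realType} {n} (x : 'rV[R]_n) (r : R) :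
  measurable (@rV_of_tuple R n @^-1` box x r).
Proof.
rewrite (_ : _ @^-1` _ = \bigcap_(i in [set: 'I_n])
    ((fun y : n.-tuple (measurableTypeR R) => tnth y i) @^-1`
     `[x ord0 i - r, x ord0 i + r])).
  apply: fin_bigcap_measurable; [exact: finite_finset|move=> i _]; rewrite -[X in measurable X]setTI.
  exact: (@measurable_tnth _ (measurableTypeR R) n i measurableT).
apply/seteqP; split => y /= h i; have := h i; rewrite /= in_itv /= mxE.
  by rewrite ler_distl.
by move=> /(_ I); rewrite ler_distl.
Qed.

Lemma leb_box {R : realType} {n} (x : 'rV[R]_n) (r : R) : 0 <= r ->
  leb R n (@rV_of_tuple R n @^-1` box x r) = ((r *+ 2) ^+ n)%:E.
Proof.
move=> r0; elim: n x => [|n IH] x /=.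
  by rewrite diracE expr0 mem_set// => -[].
rewrite /leb_step /pushforward.
pose x' : 'rV[R]_n := \row_i x ord0 (lift ord0 i).
rewrite (_ : _ @^-1` _ = `[x ord0 ord0 - r, x ord0 ord0 + r] `*`
  (@rV_of_tuple R n @^-1` box x' r)).
  rewrite product_measure1E//=; last exact: measurable_box.
  rewrite [X in (_ * X)%E]IH lebesgue_measure_itv /= lte_fin.
  rewrite exprS EFinM; case: ltP => h.
    by rewrite -EFinB; congr ((_)%:E * _)%E; rewrite mulr2n; lra.
  have -> : r = 0 by lra.
  by rewrite mul0rn !mul0e.
apply/seteqP; split => -[s y] /=.
  move=> h; split => /=.
    by have := h ord0; rewrite !mxE tnth_tcons0 in_itv /= ler_distl.
  by move=> i; have := h (lift ord0 i); rewrite !mxE tnth_tconsS.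
move=> [/= hs h] i; rewrite mxE; case: (unliftP ord0 i) => [j|] ->.
  by have := h j; rewrite !mxE tnth_tconsS.
by rewrite tnth_tcons0 ler_distl; move: hs; rewrite in_itv.
Qed.

(** Boxes with rational centre and radius 1/(k+1) are countably many, and an open set is the
    union of those that it contains. *)
Lemma measurable_open_rV {R : realType} {n} (O : set 'rV[R]_n) :
  open O -> measurable (@rV_of_tuple R n @^-1` O).
Proof.
move=> oO.
pose C (p : 'rV[rat]_n * nat) : set 'rV[R]_n :=
  box (\row_i ratr (p.1 ord0 i)) (p.2.+1%:R^-1).
pose F p : set (n.-tuple (measurableTypeR R)) :=
  if asbool (C p `<=` O) then @rV_of_tuple R n @^-1` C p else set0.
rewrite (_ : _ @^-1` O = \bigcup_p F p).
  apply: countable_bigcupT_measurable => // p.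
  by rewrite /F; case: ifP => _; [exact: measurable_box|exact: measurable0].
apply/seteqP; split => y /=; last first.
  by move=> [p _]; rewrite /F; case: asboolP => // CO /CO.
move=> Oy; have /nbhs_ballP[e /= e0 he] : nbhs (rV_of_tuple y) O.
  exact: open_nbhs_nbhs.
have [k _ /(_ k (leqnn _)) hk] : \forall k \near \oo, (k.+1%:R^-1 : R) < e / 2.
  by apply: near_infty_natSinv_lt (PosNum (divr_gt0 e0 _)).
have k0 : 0 < k.+1%:R^-1 :> R by [].
set d := k.+1%:R^-1 in hk k0.
have /choice[c hc] : forall i : 'I_n, exists q : rat,
    `|tnth y i - ratr q| <= d.
  move=> i; have : tnth y i - d < tnth y i + d by lra.
  move=> /rat_in_itvoo[q]; rewrite in_itv /= => /andP[q1 q2]; exists q.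
  by rewrite ler_distl; apply/andP; split; [rewrite lerBlDl -lerBlDr|rewrite -lerBlDr]; lra.
exists (\row_i c i, k) => //; rewrite /F; case: asboolP => [_ i|]; last first.
  case => z hz; apply: he; rewrite -ball_normE /=.
  apply: (@le_lt_trans _ _ (2 * d)); last by lra.
  apply: norm_le_coord => [|i]; first by lra.
  have := hz i; have := hc i; rewrite !mxE -/d => h1 h2.
  rewrite (_ : _ - _ = (tnth y i - ratr (c i)) - (z ord0 i - ratr (c i))); last by ring.
  by apply: le_trans (ler_normB _ _) _; lra.
by have := hc i; rewrite !mxE.
Qed.

Lemma measurable_continuous_rV {R : realType} {n} (f : 'rV[R]_n -> R) :
  continuous f -> measurable_fun setT (f \o @rV_of_tuple R n).
Proof.
move=> /continuousP cf; apply: (measurability _ (measurable_realfun.RGenOpens.measurableE R)).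
move=> _ [_ [a [b ->] <-]]; rewrite setTI comp_preimage.
by apply: measurable_open_rV; apply: cf; exact: interval_open.
Qed.

(** * Integrals of compactly supported continuous functions *)

Definition supp_in {R : realType} {n} (L : R) (f : 'rV[R]_n -> R) :=
  forall x, L < `|x| -> f x = 0.

Definition integral_Rn {R : realType} {n} (f : 'rV[R]_n -> R) : R :=
  \int[leb R n]_y f (rV_of_tuple y).

Lemma bounded_on_slab {R : realType} {n} (f : 'rV[R]_n * R -> R) (L a b : R) :
  continuous f -> exists M, [/\ 0 <= M & forall x s, `|x| <= L -> a <= s <= b ->
    `|f (x, s)| <= M].
Proof.
move=> cf.
pose K : set ('rV[R]_n * R) := [set x | `|x| <= L] `*` `[a, b].
have cK : compact K.
  apply: compact_setX; last exact: segment_compact.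
  apply: bounded_closed_compact.
    exists L; split; first by rewrite num_real.
    by move=> M LM x /= xL; apply: le_trans xL (ltW LM).
  apply: (@closed_comp _ _ (fun x : 'rV[R]_n => `|x|) [set s : R | s <= L]).
    by move=> x _; exact: norm_continuous.
  exact: closed_le.
have [K0|nK] := pselect (K !=set0); last first.
  exists 0; split => // x s xL sab; exfalso; apply: nK; exists (x, s).
  by split => //=; rewrite in_itv.
have [|c _ hc] := @compact_EVT_max _ R (fun p => `|f p|) K K0 cK.
  apply: continuous_subspaceT => p; apply: continuous_comp; first exact: cf.
  exact: norm_continuous.
exists `|f c|; split=> // x s xL sab; apply: (hc (x, s)).
by rewrite inE; split => //=; rewrite in_itv.
Qed.

(** The support has finite measure and the function is bounded on it. *)
Lemma integrable_supp_in {R : realType} {n} (f : 'rV[R]_n -> R) (L : R) :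
  continuous f -> supp_in L f ->
  (leb R n).-integrable setT (EFin \o (f \o @rV_of_tuple R n)).
Proof.
move=> cf sf; wlog L0 : L sf / 0 <= L.
  move=> /(_ (Num.max L 0)); apply; last by rewrite le_max lexx orbT.
  by move=> x; rewrite gt_max => /andP[/sf].
have [M [M0 hM]] : exists M, [/\ 0 <= M & forall x s, `|x| <= L -> 0 <= s <= (1 : R) ->
    `|f x| <= M].
  apply: (@bounded_on_slab R n (f \o fst)) => x.
  by apply: continuous_comp; [exact: cvg_fst|exact: cf].
have mB := @measurable_box R n 0 L.
rewrite (_ : EFin \o _ = (EFin \o (f \o @rV_of_tuple R n)) \_
    (@rV_of_tuple R n @^-1` box 0 L)).
  rewrite -integrable_mkcond//; apply: measurable_bounded_integrable => //.
  - by rewrite [X in (X < _)%E]leb_box// ltry.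
  - by apply: measurable_funTS; exact: measurable_continuous_rV.
  - exists M; split; first by rewrite num_real.
    move=> M' MM' y /=; rewrite boxE//= subr0 => yL.
    by apply: le_trans (hM _ 0 yL _) (ltW MM'); rewrite lexx ler01.
apply/funext => y; rewrite /patch /=; case: ifPn => //.
rewrite notin_setE /= boxE//= subr0 => /negP; rewrite -ltNge => /sf ->//.
Qed.

Section integral_Rn_theory.
Context {R : realType} {n : nat}.
Implicit Types (f g : 'rV[R]_n -> R) (L : R).

Lemma integral_RnD L f g : continuous f -> supp_in L f -> continuous g -> supp_in L g ->
  integral_Rn (fun x => f x + g x) = integral_Rn f + integral_Rn g.
Proof.
by move=> cf sf cg sg; rewrite /integral_Rn RintegralD//; exact: (integrable_supp_in _ L).
Qed.

Lemma integral_RnZ L f (c : R) : continuous f -> supp_in L f ->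
  integral_Rn (fun x => c * f x) = c * integral_Rn f.
Proof.
by move=> cf sf; rewrite /integral_Rn RintegralZl//; exact: (integrable_supp_in _ L).
Qed.

Lemma le_integral_Rn L f g : continuous f -> supp_in L f -> continuous g -> supp_in L g ->
  (forall x, f x <= g x) -> integral_Rn f <= integral_Rn g.
Proof.
move=> cf sf cg sg fg; rewrite /integral_Rn; apply: le_Rintegral => //;
  exact: (integrable_supp_in _ L).
Qed.

Lemma integral_Rn_sum L m (f : 'I_m -> 'rV[R]_n -> R) : 
  (forall i, continuous (f i)) -> (forall i, supp_in L (f i)) ->
  integral_Rn (fun x => \sum_(i < m) f i x) = \sum_(i < m) integral_Rn (f i).
Proof.
elim: m f => [|m IH] f cf sf.
  rewrite big_ord0 (_ : (fun _ => _) = fun _ => 0); last first.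
    by apply/funext => x; rewrite big_ord0.
  by rewrite /integral_Rn Rintegral_cst// mul0r.
rewrite big_ord_recl -IH// -(@integral_RnD L)//.
- by congr integral_Rn; apply/funext => x; rewrite big_ord_recl.
- by move=> x; refine (cont_sum _ _ _ x _) => i; exact: cf.
- by move=> x Lx; rewrite big1// => i _; exact: sf.
Qed.

Lemma continuous_slice (f : 'rV[R]_n * R -> R) t :
  continuous f -> continuous (fun x => f (x, t)).
Proof.
move=> cf x; apply: (@continuous_comp _ _ _ (fun x => (x, t)) f); last exact: cf.
by apply: cont_pair; [exact: cont_id|exact: cst_continuous].
Qed.

Lemma continuous_slicet (f : 'rV[R]_n * R -> R) x :
  continuous f -> continuous (fun t => f (x, t)).
Proof.
move=> cf t; apply: (@continuous_comp _ _ _ (fun t => (x, t)) f); last exact: cf.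
by apply: cont_pair; [exact: cst_continuous|exact: cont_id].
Qed.

(** A continuous majorant, with compact support, of all functions that are bounded by [M] and
    supported in the ball of radius [L]: the dominating function in passages to the limit
    under the integral. *)
Definition plateau (L M : R) (x : 'rV[R]_n) : R :=
  M * Num.min 1 (Num.max 0 (L + 1 - `|x|)).

Lemma plateau_continuous L M : continuous (plateau L M).
Proof.
move=> x; refine (contM _ _ x _ _); first exact: cont_cst.
apply: cont_min; first exact: cont_cst.
apply: cont_max; first exact: cont_cst.
by apply: contB; [exact: cont_cst|exact: norm_continuous].
Qed.

Lemma plateau_supp L M : supp_in (L + 1) (plateau L M).
Proof.
move=> x Lx; rewrite /plateau max_l; last by lra.
by rewrite min_r ?mulr0.
Qed.

Lemma plateau_ub L M (f : 'rV[R]_n -> R) : 0 <= M -> supp_in L f ->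
  (forall x, `|x| <= L -> `|f x| <= M) -> forall x, `|f x| <= plateau L M x.
Proof.
move=> M0 sf fM x; rewrite /plateau; case: (leP `|x| L) => xL.
  by rewrite max_r ?min_l ?mulr1 ?fM//; lra.
by rewrite sf// normr0 mulr_ge0// le_min ler01 le_max lexx.
Qed.

Lemma integral_Rn_continuous L (f : 'rV[R]_n * R -> R) :
  continuous f -> (forall t, supp_in L (fun x => f (x, t))) ->
  continuous (fun t => integral_Rn (fun x => f (x, t))).
Proof.
move=> cf sf t.
have [M [M0 hM]] := bounded_on_slab f L (t - 1) (t + 1) cf.
pose F s (y : n.-tuple (measurableTypeR R)) := f (rV_of_tuple y, s).
have intF s : (leb R n).-integrable setT (EFin \o F s).
  exact: (integrable_supp_in _ L (continuous_slice _ s cf)).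
have := @continuity_under_integral R _ _ (leb R n) F setT measurableT (t - 1)
  (t + 1) (fun s _ => intF s) _ (plateau L M \o @rV_of_tuple R n) _ _ t _.
apply.
- by apply: aeW => y _ s _; exact: continuous_slicet.
- exact: (integrable_supp_in _ _ (plateau_continuous _ _) (@plateau_supp _ _)).
- move=> s /= sI; apply: aeW => y _.
  apply: (plateau_ub L M (fun x => f (x, s))) => // x xL; apply: hM => //.
  by move: sI; rewrite in_itv /=; lra.
- by rewrite inE /= in_itv /=; lra.
Qed.

Lemma integral_Rn_is_derive L M (f g : 'rV[R]_n * R -> R) (p q t : R) :
  p < t < q -> 0 <= M ->
  (forall s, p < s < q -> continuous (fun x => f (x, s))) ->
  (forall s, supp_in L (fun x => f (x, s))) ->
  (forall x s, p < s < q -> is_derive s 1 (fun s => f (x, s)) (g (x, s))) ->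
  (forall x s, p < s < q -> `|g (x, s)| <= M) ->
  is_derive t 1 (fun s => integral_Rn (fun x => f (x, s))) (integral_Rn (fun x => g (x, t))).
Proof.
move=> ptq M0 cf sf dfg gM.
pose F s (y : n.-tuple (measurableTypeR R)) := f (rV_of_tuple y, s).
have intF s : p < s < q -> (leb R n).-integrable setT (EFin \o F s).
  by move=> spq; apply: (@integrable_supp_in _ _ _ L (cf _ spq)).
have sg s : p < s < q -> supp_in L (fun x => g (x, s)).
  move=> spq x Lx; have [_ <-] := dfg x s spq.
  rewrite (_ : (fun s => _) = cst 0) ?derive_cst//.
  by apply/funext => s'; exact: sf.
have d1 y s : p < s < q -> partial1of2 F s y = g (rV_of_tuple y, s).
  by move=> spq; rewrite partial1of2E; have [_ <-] := dfg (rV_of_tuple y) s spq.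
have H := @derivable_under_integral R _ _ (leb R n) F setT measurableT t p q.
have H2 := @differentiation_under_integral R _ _ (leb R n) F setT measurableT t p q.
have P1 : `]p, q[%classic t by rewrite /= in_itv.
have P2 x : `]p, q[%classic x -> (leb R n).-integrable setT (EFin \o F x).
  by rewrite /= in_itv /= => /intF.
have P3 x y : `]p, q[%classic x -> setT y -> derivable (F^~ y) x 1.
  rewrite /= in_itv /= => xpq _; by have [] := dfg (rV_of_tuple y) x xpq.
have P4 y : 0 <= (plateau L M \o @rV_of_tuple R n) y.
  by rewrite /= /plateau mulr_ge0// le_min ler01 le_max lexx.
have P5 : (leb R n).-integrable setT (EFin \o (plateau L M \o @rV_of_tuple R n)).
  exact: (integrable_supp_in _ _ (plateau_continuous _ _) (@plateau_supp _ _)).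
have P6 x y : `]p, q[%classic x -> setT y ->
    `|partial1of2 F x y| <= (plateau L M \o @rV_of_tuple R n) y.
  rewrite /= in_itv /= => xpq _; rewrite d1//.
  by apply: (plateau_ub L M (fun z => g (z, x))) => //; [exact: sg|move=> *; exact: gM].
apply: DeriveDef; first exact: (H P1 P2 P3 _ P4 P5 P6).
rewrite -derive1E (H2 P1 P2 P3 _ P4 P5 P6).
by apply: eq_Rintegral => y _; exact: d1.
Qed.

End integral_Rn_theory.

(** * The integral of a partial derivative vanishes *)

Lemma integral_derive_supp {R : realType} (L : R) (g dg : R -> R) :
  (forall s : R, is_derive s 1 g (dg s)) -> continuous dg ->
  (forall s, L < `|s| -> g s = 0) ->
  (\int[@lebesgue_measure R]_s (dg s)%:E = 0)%E.
Proof.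
(* One unit beyond the support, so that g vanishes near each s with M < |s| and at M. *)
move=> Dg cdg sg; pose M := Num.max L 0 + 1.
have M0 : 0 < M by rewrite /M; case: (leP L 0) => h; lra.
have LM : L < M by rewrite /M; case: (leP L 0) => h; lra.
have dg0 s : M < `|s| -> dg s = 0.
  move=> Ms; have [_ <-] := Dg s.
  rewrite (@near_eq_derive _ _ _ g (cst 0)) ?derive_cst//.
  have /continuousP_norm/(_ (`|s| - M)) : {for s, continuous (fun z : R => z)}.
    exact: cont_id.
  case=> [|d d0 hd]; first by rewrite subr_gt0.
  apply/nbhs_ballP; exists d => // z; rewrite -ball_normE /= distrC => /hd zs.
  apply: sg; apply: lt_trans LM _; have := lerB_dist s (s - z).
  have -> : s - (s - z) = z by ring.
  by rewrite distrC; lra.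
transitivity (\int[@lebesgue_measure R]_(s in `[(- M)%R, M]) (dg s)%:E)%E.
  rewrite [RHS]integral_mkcond; apply: eq_integral => s _.
  rewrite /patch; case: ifPn => //; rewrite notin_setE /= in_itv /= => /negP h.
  by rewrite dg0// ltNge ler_norml.
rewrite (@continuous_FTC2 _ _ g).
- by rewrite !sg ?subee// ?normrN gtr0_norm.
- by lra.
- exact: continuous_subspaceT.
- have cg s : {for s, continuous g}.
    by apply/differentiable_continuous/derivable1_diffP; have [] := Dg s.
  split.
  + by move=> s _; have [] := Dg s.
  + exact: cvg_at_right_filter (cg _).
  + exact: cvg_at_left_filter (cg _).
- by move=> s _; rewrite derive1E; have [] := Dg s.
Qed.

Definition cons_rV {R : realType} {n} (s : R) (z : 'rV[R]_n) : 'rV[R]_n.+1 :=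
  \row_i if unlift ord0 i is Some j then z ord0 j else s.

Section cons_rV_theory.
Context {R : realType} {n : nat}.
Implicit Types (s : R) (z : 'rV[R]_n).

Lemma cons_rV0 s z : cons_rV s z ord0 ord0 = s.
Proof. by rewrite mxE unlift_none. Qed.

Lemma cons_rVS s z j : cons_rV s z ord0 (lift ord0 j) = z ord0 j.
Proof. by rewrite mxE liftK. Qed.

Lemma rV_of_tuple_tcons s (y : n.-tuple (measurableTypeR R)) :
  rV_of_tuple (tcons (s, y)) = cons_rV s (rV_of_tuple y).
Proof.
apply/rowP => i; case: (unliftP ord0 i) => [j|] ->.
  by rewrite cons_rVS !mxE tnth_tconsS.
by rewrite cons_rV0 !mxE tnth_tcons0.
Qed.

Lemma cons_rV_line0 h s z :
  cons_rV (h + s) z = h *: basis_vec R ord0 + cons_rV s z.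
Proof.
apply/rowP => i; case: (unliftP ord0 i) => [j|] ->.
  by rewrite [RHS]mxE !cons_rVS !mxE /= mulr0 add0r.
by rewrite [RHS]mxE !cons_rV0 !mxE /= mulr1.
Qed.

Lemma cons_rV_lineS h j s z :
  cons_rV s (h *: basis_vec R j + z) = h *: basis_vec R (lift ord0 j) + cons_rV s z.
Proof.
apply/rowP => i; case: (unliftP ord0 i) => [k|] ->.
  by rewrite [RHS]mxE !cons_rVS !mxE /= (inj_eq (@lift_inj _ ord0)).
by rewrite [RHS]mxE !cons_rV0 !mxE /= mulr0 add0r.
Qed.

Lemma norm_cons_rV s z : `|s| <= `|cons_rV s z| /\ `|z| <= `|cons_rV s z|.
Proof.
split; first by have := coord_le_norm (cons_rV s z) ord0; rewrite cons_rV0.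
apply: norm_le_coord => // j.
by have := coord_le_norm (cons_rV s z) (lift ord0 j); rewrite cons_rVS.
Qed.

Lemma dist_cons_rV s s' z z' :
  `|cons_rV s z - cons_rV s' z'| <= Num.max `|s - s'| `|z - z'|.
Proof.
apply: norm_le_coord => [|i]; first by rewrite le_max normr_ge0.
case: (unliftP ord0 i) => [j|] ->; rewrite !mxE ?liftK ?unlift_none.
  by rewrite le_max; have := coord_le_norm (z - z') j; rewrite !mxE => ->; rewrite orbT.
by rewrite le_max lexx.
Qed.

Lemma cons_rV_continuous s : continuous (cons_rV s : 'rV[R]_n -> _).
Proof.
move=> z; apply/continuousP_norm => e e0; exists e => // z' z'z.
apply: le_lt_trans (dist_cons_rV _ _ _ _) _.
by rewrite subrr normr0 max_r.
Qed.

Lemma cons_rV_continuousl z : continuous (cons_rV ^~ z).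
Proof.
move=> s; apply/continuousP_norm => e e0; exists e => // s' s's.
apply: le_lt_trans (dist_cons_rV _ _ _ _) _.
by rewrite subrr normr0 max_l.
Qed.

End cons_rV_theory.

(** Fubini's theorem separates the first coordinate from the others. If [i] is the first
    coordinate, the integral in this variable is that of the derivative of a compactly
    supported function; otherwise the integral over the other variables vanishes by
    induction on the dimension. *)
Lemma integral_Rn_partial0 {R : realType} {n} (i : 'I_n) (L : R) (G dG : 'rV[R]_n -> R) :
  (forall x, is_derive x (basis_vec R i) G (dG x)) -> continuous dG ->
  supp_in L G -> supp_in L dG -> integral_Rn dG = 0.
Proof.
elim: n i G dG => [|n IH] i G dG DG cdG sG sdG; first by case: (i).
pose f (p : measurableTypeR R * n.-tuple (measurableTypeR R)) : \bar R :=
  (dG (rV_of_tuple (tcons p)))%:E.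
have mf : measurable_fun setT
    (fun y : n.+1.-tuple (measurableTypeR R) => (dG (rV_of_tuple y))%:E).
  by apply/measurable_EFinP; exact: measurable_continuous_rV.
have If := integrable_supp_in dG L cdG sdG.
have Ip : (product_measure1 (@lebesgue_measure R) (leb R n)).-integrable setT f.
  have := If; rewrite /= /leb_step.
  move=> /integrableP[_ fin]; apply/integrableP; split.
    by apply: (measurableT_comp mf); exact: measurable_tcons.
  apply: le_lt_trans fin; rewrite ge0_integral_pushforward//=.
    exact: measurable_tcons.
  exact: (measurableT_comp (@abse_measurable R setT) mf).
suff E : (\int[leb R n.+1]_y (dG (rV_of_tuple y))%:E = 0)%E.
  by rewrite /integral_Rn /Rintegral E.
rewrite /= /leb_step integral_pushforward//=; first last.
- exact: measurable_tcons.
rewrite preimage_setT -[LHS]/(\int[_]_z f z)%E.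
case: (unliftP ord0 i) => [j|] ij.
  rewrite -integral12_prod_meas1//; apply: integral0_eq => s _; rewrite /fubini_F /f.
  under eq_integral do rewrite rV_of_tuple_tcons.
  have cs : continuous (fun z : 'rV[R]_n => dG (cons_rV s z)).
    by move=> z; apply: continuous_comp; [exact: cons_rV_continuous|exact: cdG].
  have ss : supp_in L (fun z : 'rV[R]_n => dG (cons_rV s z)).
    by move=> z Lz; apply: sdG; apply: lt_le_trans Lz _; have [] := norm_cons_rV s z.
  have ds z : is_derive z (basis_vec R j) (fun z => G (cons_rV s z)) (dG (cons_rV s z)).
    apply/is_derive_line0; have /is_derive_line0 := DG (cons_rV s z).
    by rewrite ij; congr is_derive; apply/funext => t; rewrite cons_rV_lineS.
  have gs : supp_in L (fun z : 'rV[R]_n => G (cons_rV s z)).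
    by move=> z Lz; apply: sG; apply: lt_le_trans Lz _; have [] := norm_cons_rV s z.
  have := IH j (fun z => G (cons_rV s z)) (fun z => dG (cons_rV s z)) ds cs gs ss.
  rewrite /integral_Rn /Rintegral => h; rewrite -[LHS]fineK ?h//.
  by apply: integrable_fin_num => //; exact: (integrable_supp_in _ L cs ss).
rewrite -integral21_prod_meas1//; apply: integral0_eq => y _; rewrite /fubini_G /f.
under eq_integral do rewrite rV_of_tuple_tcons.
set z := rV_of_tuple y.
apply: (integral_derive_supp L (fun s => G (cons_rV s z)) (fun s => dG (cons_rV s z))).
- move=> s; have /is_derive_line0 := DG (cons_rV s z).
  rewrite ij => h; apply/is_derive_line0.
  move: h; congr is_derive; apply/funext => t.
  by rewrite /GRing.scale /= mulr1 cons_rV_line0.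
- by move=> s; apply: continuous_comp; [exact: cons_rV_continuousl|exact: cdG].
- by move=> s Ls; apply: sG; apply: lt_le_trans Ls _; have [] := norm_cons_rV s z.
Qed.

(** * Integral comparisons *)

(** The integral of a nonnegative function is a supremum over the simple functions below it,
    hence monotone without measurability. This is what compares the growth hypothesis, an
    iterated integral, with the integral in time of a continuous function. *)
Lemma ge0_le_integral_nomeas d (T : measurableType d) {R : realType}
    (mu : {measure set T -> \bar R}) (D1 D2 : set T) (f g : T -> \bar R) :
  (forall x, D1 x -> 0 <= f x)%E -> (forall x, D2 x -> 0 <= g x)%E ->
  (forall x, (f \_ D1) x <= (g \_ D2) x)%E ->
  (\int[mu]_(x in D1) f x <= \int[mu]_(x in D2) g x)%E.
Proof.
move=> f0 g0 fg; rewrite (integral_mkcond D1) (integral_mkcond D2).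
rewrite !ge0_integralTE; last 2 first.
- exact: erestrict_ge0.
- exact: erestrict_ge0.
apply: ereal_sup_le => _ [h /= hf <-]; exists h => //= x.
exact: le_trans (hf x) (fg x).
Qed.

Lemma integral_Rn_ge_box {R : realType} {n} (L r b : R) (x : 'rV[R]_n) (f : 'rV[R]_n -> R) :
  continuous f -> supp_in L f -> (forall z, 0 <= f z) -> 0 <= r -> 0 <= b ->
  (forall z, box x r z -> b <= f z) -> b * (r *+ 2) ^+ n <= integral_Rn f.
Proof.
move=> cf sf f0 r0 b0 fb.
have If := integrable_supp_in f L cf sf.
rewrite -lee_fin [leRHS]fineK; last exact: integrable_fin_num If.
rewrite EFinM -(leb_box x)//.
have mB := @measurable_box R n x r.
rewrite -[X in (X <= _)%E](integral_cst (leb R n) mB b%:E).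
apply: ge0_le_integral_nomeas.
- by move=> y _; rewrite lee_fin.
- by move=> y _; rewrite lee_fin.
- move=> y; rewrite patch_setT /patch; case: ifPn => //; last by rewrite lee_fin.
  by rewrite inE /= lee_fin => /fb.
Qed.

(** [E] minus [M] times a primitive of [J] has a nonpositive derivative. *)
Lemma le_increment_integral {R : realType} (E J : R -> R) (M p q : R) : p < q ->
  continuous E -> continuous J ->
  (forall t, p < t < q -> exists2 dE, is_derive t 1 E dE & dE <= M * J t) ->
  E q - E p <= M * \int[@lebesgue_measure R]_(t in `[p, q]) J t.
Proof.
move=> pq cE cJ dE.
have IJ : (@lebesgue_measure R).-integrable `[p - 1, q + 1] (EFin \o J).
  by apply: continuous_compact_integrable; [exact: segment_compact|exact: continuous_subspaceT].
pose F x := \int[@lebesgue_measure R]_(t in `[p - 1, x]) J t.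
have dF x : p - 1 < x < q + 1 -> is_derive x 1 F (J x).
  move=> /andP[px xq].
  have [d1 d2] := @continuous_FTC1_closed R J (p - 1) x (q + 1) xq IJ px (cJ x).
  by apply: DeriveDef => //; rewrite -derive1E.
have -> : \int[@lebesgue_measure R]_(t in `[p, q]) J t = F q - F p.
  rewrite -Rintegral_itv_obnd_cbnd; last first.
    apply: integrableS IJ => // z; rewrite /= !in_itv /=; lra.
  rewrite -(@Rintegral_itvB _ _ (BLeft (p - 1)))//.
  - by apply: integrableS IJ => //; apply: subset_itvl; rewrite bnd_simp; lra.
  - by rewrite bnd_simp; lra.
  - by rewrite bnd_simp; lra.
pose P x := E x - M * F x.
suff : P q <= P p by rewrite /P; lra.
have dP x : p < x < q -> exists2 dE, is_derive x 1 P dE & dE <= 0.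
  move=> pxq; have [e He eJ] := dE x pxq; exists (e - (0 * F x + M * J x)); last by lra.
  apply: dirB => //; apply: dirM.
  by apply: dF; lra.
apply: (@ler0_derive1_le_cc _ P p q).
- by move=> x; rewrite in_itv /= => /dP[e []].
- by move=> x; rewrite in_itv /= => /dP[e [_ <-]]; rewrite derive1E.
- apply: continuous_in_subspaceT => x; rewrite inE /= in_itv /= => xpq.
  refine (contB _ _ x _ _); first exact: cE.
  refine (contM _ _ x _ _); first exact: cont_cst.
  by apply/differentiable_continuous/derivable1_diffP; have [] := dF x ltac:(lra).
- by rewrite in_itv /= lexx ltW.
- by rewrite in_itv /= lexx ltW.
- exact: ltW.
Qed.

(** * Euclidean distance to the boundary *)

(** The weights allow two uses: the inequality in R^n, with weights 1, and the passage from the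
    gradients of the terms of the barrier to the gradient of their sum. *)
Lemma cauchy_schwarz {R : realType} (I : finType) (e a b : I -> R) :
  (forall i, 0 <= e i) ->
  (\sum_i e i * (a i * b i)) ^+ 2 <=
  (\sum_i e i * a i ^+ 2) * (\sum_i e i * b i ^+ 2).
Proof.
move=> e0; set X := \sum_i _; set A := \sum_i e i * a i ^+ 2; set B := \sum_i e i * _ ^+ 2.
have A0 : 0 <= A by apply: sumr_ge0 => i _; rewrite mulr_ge0 ?sqr_ge0.
have : 0 <= \sum_i e i * (A * b i - X * a i) ^+ 2.
  by apply: sumr_ge0 => i _; rewrite mulr_ge0 ?sqr_ge0.
have -> : \sum_i e i * (A * b i - X * a i) ^+ 2 = A * (A * B - X ^+ 2).
  rewrite (eq_bigr (fun i => A ^+ 2 * (e i * b i ^+ 2) -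
    (2 * A * X) * (e i * (a i * b i)) + X ^+ 2 * (e i * a i ^+ 2))); last first.
    by move=> i _; ring.
  by rewrite big_split sumrB /= -!mulr_sumr -/X -/A -/B; ring.
have [Agt0|] := ltP 0 A; first by rewrite pmulr_rge0// subr_ge0.
move=> Ale0 _; have AE : A = 0 by apply/eqP; rewrite eq_le Ale0.
suff -> : X = 0 by rewrite expr0n /= AE mul0r.
rewrite /X big1// => i _.
have : \sum_i e i * a i ^+ 2 == 0 by rewrite -/A AE.
rewrite psumr_eq0; last by move=> j _; rewrite mulr_ge0 ?sqr_ge0.
move=> /allP/(_ i); rewrite mem_index_enum => /(_ isT) /=.
by rewrite mulf_eq0 sqrf_eq0 => /orP[/eqP ->|/eqP ->]; rewrite ?mul0r// mulr0.
Qed.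

Section euclidean.
Context {R : realType} {n : nat}.
Implicit Types (x y z v : 'rV[R]_n) (Omega : set 'rV[R]_n).

Definition sqdist x y : R := \sum_(i < n) (x ord0 i - y ord0 i) ^+ 2.

Lemma sqdist_ge0 x y : 0 <= sqdist x y.
Proof. by apply: sumr_ge0 => i _; exact: sqr_ge0. Qed.

Lemma enorm_ge0 v : 0 <= enorm v.
Proof. exact: sqrtr_ge0. Qed.

Lemma enorm_sqr v : enorm v ^+ 2 = \sum_(i < n) v ord0 i ^+ 2.
Proof. by rewrite sqr_sqrtr//; apply: sumr_ge0 => i _; exact: sqr_ge0. Qed.

Lemma enorm_sqd x y : enorm (x - y) ^+ 2 = sqdist x y.
Proof. by rewrite enorm_sqr; apply: eq_bigr => i _; rewrite !mxE. Qed.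

Lemma enormC x y : enorm (x - y) = enorm (y - x).
Proof.
apply/eqP; rewrite -(eqrXn2 (ltn0Sn 1)) ?enorm_ge0// !enorm_sqd; apply/eqP.
by apply: eq_bigr => i _; ring.
Qed.

Lemma enorm0 : enorm (0 : 'rV[R]_n) = 0.
Proof.
by rewrite /enorm big1 ?sqrtr0// => i _; rewrite mxE expr0n.
Qed.

Lemma ler_enormD x y : enorm (x + y) <= enorm x + enorm y.
Proof.
have s0 : 0 <= enorm x + enorm y by rewrite addr_ge0 ?enorm_ge0.
rewrite -(ler_pXn2r (ltn0Sn 1)) ?nnegrE ?enorm_ge0// sqrrD !enorm_sqr.
have -> : \sum_i (x + y) ord0 i ^+ 2 = \sum_i x ord0 i ^+ 2 +
    (\sum_i x ord0 i * y ord0 i) *+ 2 + \sum_i y ord0 i ^+ 2.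
  by rewrite -sumrMnl -!big_split; apply: eq_bigr => i _; rewrite !mxE /=; ring.
rewrite lerD2r lerD2l lerMn2r /=; apply: le_trans (ler_norm _) _.
rewrite -(ler_pXn2r (ltn0Sn 1)) ?nnegrE ?mulr_ge0 ?enorm_ge0// real_normK ?num_real//.
rewrite exprMn !enorm_sqr.
have := cauchy_schwarz _ (fun=> 1) (fun i => x ord0 i) (fun i => y ord0 i) (fun=> ler01).
have E (f : 'I_n -> R) : \sum_i 1 * f i = \sum_i f i.
  by apply: eq_bigr => i _; rewrite mul1r.
by rewrite !E.
Qed.

Lemma enorm_le_norm v : enorm v <= n.+1%:R * `|v|.
Proof.
rewrite -(ler_pXn2r (ltn0Sn 1)) ?nnegrE ?mulr_ge0 ?enorm_ge0// enorm_sqr.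
apply: (@le_trans _ _ (\sum_(i < n) `|v| ^+ 2)).
  apply: ler_sum => i _; rewrite -real_normK ?num_real//.
  by rewrite ler_pXn2r ?nnegrE//; exact: coord_le_norm.
rewrite sumr_const card_ord exprMn -[leLHS]mulr_natl ler_wpM2r ?sqr_ge0//.
by rewrite -natrX ler_nat -mulnn (leq_trans (leqnSn n))// leq_pmulr.
Qed.

Lemma norm_le_enorm v : `|v| <= enorm v.
Proof.
apply: norm_le_coord => [|i]; first exact: enorm_ge0.
rewrite -(ler_pXn2r (ltn0Sn 1)) ?nnegrE ?enorm_ge0// enorm_sqr real_normK ?num_real//.
by rewrite (bigD1 i)//= lerDl sumr_ge0// => j _; exact: sqr_ge0.
Qed.

Lemma bdist_le Omega x y : boundary Omega y -> bdist Omega x <= enorm (x - y).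
Proof.
move=> By; apply: ge_inf; last by exists y.
by exists 0 => _ [z _ <-]; exact: enorm_ge0.
Qed.

(** The infimum of the empty set is 0. *)
Lemma bdist_empty Omega x : ~ (boundary Omega !=set0) -> bdist Omega x = 0.
Proof.
move=> nB; rewrite /bdist (_ : [set _ | _ in _] = set0) ?inf0//.
by apply/seteqP; split => // r [y By _]; apply: nB; exists y.
Qed.

Lemma bdist_ge0 Omega x : 0 <= bdist Omega x.
Proof.
have [[y0 By0]|nB] := pselect (boundary Omega !=set0); last by rewrite bdist_empty.
apply: lb_le_inf; first by exists (enorm (x - y0)), y0.
by move=> _ [z _ <-]; exact: enorm_ge0.
Qed.

Lemma bdist_lipschitz Omega x z : bdist Omega x <= bdist Omega z + enorm (x - z).
Proof.
have [[y0 By0]|nB] := pselect (boundary Omega !=set0); last first.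
  by rewrite !bdist_empty// add0r enorm_ge0.
rewrite -lerBlDr; apply: lb_le_inf; first by exists (enorm (z - y0)), y0.
move=> _ [y By <-]; rewrite lerBlDr; apply: le_trans (bdist_le _ _ _ By) _.
by have := ler_enormD (z - y) (x - z); rewrite addrC addrA subrK.
Qed.

Lemma bdist_continuous Omega : continuous (bdist Omega).
Proof.
move=> x; apply/continuousP_norm => e e0; exists (e / n.+1%:R); first by rewrite divr_gt0.
move=> z; rewrite ltr_pdivlMr// mulrC => zx.
rewrite ltr_distl; have h1 := bdist_lipschitz Omega x z.
have h2 := bdist_lipschitz Omega z x.
have h3 := enorm_le_norm (z - x); rewrite enormC in h1.
by apply/andP; split; lra.
Qed.

Definition inner_closed Omega (e : R) : set 'rV[R]_n :=
  [set x | Omega x /\ e <= bdist Omega x].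

(** A limit of points of [Omega] which is not in [Omega] lies on the boundary, where the
    distance, a continuous function, is 0. *)
Lemma inner_closed_closed Omega e : open Omega -> 0 < e ->
  closed (inner_closed Omega e).
Proof.
move=> oO e0.
have -> : inner_closed Omega e = closure Omega `&` [set x | e <= bdist Omega x].
  apply/seteqP; split => x [Ox ex]; split => //; first exact: subset_closure.
  apply: contrapT => nOx; have Bx : boundary Omega x.
    by split => //; rewrite (interior_id _).1.
  have := bdist_le _ x _ Bx; rewrite subrr enorm0; move: ex => /=; lra.
apply: closedI; first exact: closed_closure.
apply: (@closed_comp _ _ (bdist Omega) [set r : R | e <= r]).
  by move=> x _; exact: bdist_continuous.
exact: closed_ge.
Qed.

End euclidean.

Section support_extension.

(** The open set [O] and the complement of [C] cover the space, and on the latter [f] is 0.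
    The function [g] is a formula for [f] which may be meaningless off [O]. *)
Lemma cont_supp {R : realType} {T : topologicalType} (O C : set T) (f g : T -> R) :
  open O -> closed C -> C `<=` O ->
  (forall x, O x -> f x = g x) -> (forall x, ~ C x -> f x = 0) ->
  (forall x, O x -> {for x, continuous g}) -> forall x, {for x, continuous f}.
Proof.
move=> oO cC CO fg f0 cg x; have [Ox|nOx] := pselect (O x).
  have : f @ x --> g x; last by rewrite -(fg x Ox).
  apply: cvg_trans (cg x Ox); apply: near_eq_cvg.
  by have := open_nbhs_nbhs (conj oO Ox); apply: filterS => z /fg.
have nCx : ~ C x by move=> /CO.
have : f @ x --> (0 : R); last by rewrite -(f0 x nCx).
apply: (@cvg_trans _ (cst (0 : R) @ x)); last exact: cvg_cst.
apply: near_eq_cvg; have := open_nbhs_nbhs (conj (closed_openC cC) nCx).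
by apply: filterS => z /f0.
Qed.

Lemma dir_supp {R : realType} {V : normedModType R} (O C : set V) (f g df dg : V -> R) v :
  open O -> closed C -> C `<=` O ->
  (forall x, O x -> f x = g x) -> (forall x, ~ C x -> f x = 0) ->
  (forall x, O x -> df x = dg x) -> (forall x, ~ C x -> df x = 0) ->
  (forall x, O x -> is_derive x v g (dg x)) -> forall x, is_derive x v f (df x).
Proof.
move=> oO cC CO fg f0 dfg df0 dg' x; have [Ox|nOx] := pselect (O x).
  rewrite dfg//; apply: near_eq_is_derive (dg' x Ox).
  by have := open_nbhs_nbhs (conj oO Ox); apply: filterS => z /fg ->.
have nCx : ~ C x by move=> /CO.
rewrite df0//; apply: (@near_eq_is_derive _ _ _ (fun=> 0)).
have := open_nbhs_nbhs (conj (closed_openC cC) nCx).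
by apply: filterS => z /f0 ->.
Qed.

End support_extension.

(** * The smooth modulus and the truncation profile *)

Lemma is_derive_pospart {R : realType} (k : nat) (x : R) :
  is_derive x 1 (fun z => Num.max z 0 ^+ k.+2) (k.+2%:R * Num.max x 0 ^+ k.+1).
Proof.
have [x0|x0|->] := ltgtP x 0.
- rewrite expr0n /= mulr0.
  apply: (@near_eq_is_derive _ _ _ (fun=> 0)).
  have := lt_nbhsl x0; apply: filterS => z z0.
  by rewrite max_r ?(ltW z0)// expr0n.
- apply: (@near_eq_is_derive R R R (fun z : R => z ^+ k.+2)).
    have := lt_nbhsr x0; apply: filterS => z z0.
    by rewrite max_l ?(ltW z0).
  by have := dirX _ k.+1 _ _ _ (is_derive_id x (1 : R)); rewrite mulr1.
apply/is_derive1_caratheodory; exists (fun z => Num.max z 0 ^+ k.+1); split.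
- move=> z; rewrite /= maxxx expr0n /= !subr0; case: (leP z 0) => z0.
    by rewrite !expr0n /= mul0r.
  by rewrite [LHS]exprSr.
- by apply: contX; apply: cont_max; [exact: cont_id|exact: cont_cst].
- by rewrite maxxx expr0n /= mulr0.
Qed.

Section sqrt_modulus.
Context {R : realType}.
Implicit Types s : R.

(** A smooth substitute for the absolute value, below it and with the same zero. Its convexity
    ([smooth_abs''_ge0]) makes Kato's inequality hold. *)
Definition smooth_abs s : R := Num.sqrt (1 + s ^+ 2) - 1.
Definition smooth_abs' s : R := s / Num.sqrt (1 + s ^+ 2).
Definition smooth_abs'' s : R := (Num.sqrt (1 + s ^+ 2) ^+ 3)^-1.

Let rt_gt0 s : 0 < Num.sqrt (1 + s ^+ 2).
Proof. by rewrite sqrtr_gt0 ltr_wpDr// sqr_ge0. Qed.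

Let rt_sqr s : Num.sqrt (1 + s ^+ 2) ^+ 2 = 1 + s ^+ 2.
Proof. by rewrite sqr_sqrtr// addr_ge0// sqr_ge0. Qed.

Let is_derive_rt s :
  is_derive s 1 (fun s => Num.sqrt (1 + s ^+ 2)) (s / Num.sqrt (1 + s ^+ 2)).
Proof.
have p : 0 < 1 + s ^+ 2 by rewrite ltr_wpDr// sqr_ge0.
have d1 := is_derive1_sqrt p.
have d2 : is_derive s 1 (fun s : R => 1 + s ^+ 2) (2 * s).
  have := dirD _ _ _ _ _ _ (dir_cst 1 s 1) (dirX _ 1 _ _ _ (is_derive_id s (1 : R))).
  by rewrite add0r mulr1 expr1.
have := dir_comp Num.sqrt (fun s => 1 + s ^+ 2) s 1 _ _ d1 d2.
congr is_derive; have := rt_gt0 s; set r := Num.sqrt _ => r0.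
by field; rewrite gt_eqF.
Qed.

Lemma smooth_abs_derive s : is_derive s 1 smooth_abs (smooth_abs' s).
Proof.
have := dirB _ _ _ _ _ _ (is_derive_rt s) (dir_cst 1 s 1).
by rewrite subr0.
Qed.

Lemma smooth_abs'_derive s : is_derive s 1 smooth_abs' (smooth_abs'' s).
Proof.
have := dirM _ _ _ _ _ _ (is_derive_id s 1) (dirV (fun s => Num.sqrt (1 + s ^+ 2)) s 1 _ (lt0r_neq0 (rt_gt0 s)) (is_derive_rt s)).
congr is_derive; rewrite /smooth_abs''; have := rt_sqr s; have := rt_gt0 s; set r := Num.sqrt _ => r0 rE.
transitivity ((r ^+ 2 - s ^+ 2) / r ^+ 3); first by field; rewrite gt_eqF.
by rewrite rE addrK mul1r.
Qed.

Lemma smooth_abs_continuous : continuous smooth_abs.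
Proof. by move=> s; apply/differentiable_continuous/derivable1_diffP; have [] := smooth_abs_derive s. Qed.

Lemma smooth_abs'_continuous : continuous smooth_abs'.
Proof. by move=> s; apply/differentiable_continuous/derivable1_diffP; have [] := smooth_abs'_derive s. Qed.

Lemma smooth_abs''_continuous : continuous smooth_abs''.
Proof.
move=> s; refine (contV _ s _ _); first by rewrite lt0r_neq0// exprn_gt0.
apply: contX; apply/differentiable_continuous/derivable1_diffP.
by have [] := is_derive_rt s.
Qed.

Lemma smooth_abs''_ge0 s : 0 <= smooth_abs'' s.
Proof. by rewrite invr_ge0 exprn_ge0// ltW. Qed.

Lemma smooth_abs_ge0 s : 0 <= smooth_abs s.
Proof.
rewrite subr_ge0 -(ler_pXn2r (ltn0Sn 1)) ?nnegrE ?sqrtr_ge0//.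
by rewrite rt_sqr expr1n lerDl sqr_ge0.
Qed.

Lemma smooth_abs_le s : smooth_abs s <= `|s|.
Proof.
rewrite lerBlDr -(ler_pXn2r (ltn0Sn 1)) ?nnegrE ?sqrtr_ge0 ?addr_ge0//.
rewrite rt_sqr sqrrD real_normK ?num_real// expr1n mulr1.
by rewrite [leLHS]addrC -addrA lerD2l lerDr mulrn_wge0.
Qed.

Lemma smooth_abs0 : smooth_abs 0 = 0.
Proof. by rewrite /smooth_abs expr0n /= addr0 sqrtr1 subrr. Qed.

Lemma smooth_abs_gt0 s : s != 0 -> 0 < smooth_abs s.
Proof.
move=> s0; rewrite subr_gt0 -(ltr_pXn2r (ltn0Sn 1)) ?nnegrE ?sqrtr_ge0//.
by rewrite rt_sqr expr1n ltrDl exprn_even_gt0.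
Qed.

End sqrt_modulus.

Section cutoff_profile.
Context {R : realType} (K : R).
Implicit Types s : R.
Hypothesis K0 : 0 < K.

Let Z s := Num.max (K - s) 0.

(** In the variable v = 1/s this is (v - 1/K)^3 / v^2 for v > 1/K, and 0 otherwise: a convex
    truncation of v of class C^2. Its derivatives in s are [profile'] and [profile'']. *)
Definition profile s : R := Z s ^+ 3 / (s * K ^+ 3).
Definition profile' s : R := - (3 * Z s ^+ 2 / (s * K ^+ 3) + Z s ^+ 3 / (s ^+ 2 * K ^+ 3)).
Definition profile'' s : R := 6 * Z s / (s * K ^+ 3) + 6 * Z s ^+ 2 / (s ^+ 2 * K ^+ 3)
  + 2 * Z s ^+ 3 / (s ^+ 3 * K ^+ 3).

Let Z_ge0 s : 0 <= Z s.
Proof. by rewrite le_max lexx orbT. Qed.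

Let dZ k s : is_derive s 1 (fun s => Z s ^+ k.+2) (- (k.+2%:R * Z s ^+ k.+1)).
Proof.
have d : is_derive s 1 (fun s : R => K - s) (- 1).
  by have := dirB _ _ _ _ _ _ (dir_cst K s 1) (is_derive_id s 1); rewrite sub0r.
by have := dir_comp (fun z => Num.max z 0 ^+ k.+2) (fun s => K - s) s 1 _ _ (is_derive_pospart k (K - s)) d; rewrite mulrN1.
Qed.

Let dinv k s : s != 0 ->
  is_derive s 1 (fun s => (s ^+ k.+1 * K ^+ 3)^-1) (- k.+1%:R / (s ^+ k.+2 * K ^+ 3)).
Proof.
move=> s0; have h : s ^+ k.+1 * K ^+ 3 != 0.
  by rewrite mulf_neq0 ?expf_neq0// gt_eqF.
have dp : is_derive s 1 (fun s : R => s ^+ k.+1 * K ^+ 3) (k.+1%:R * s ^+ k * K ^+ 3).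
  have d1 : is_derive s 1 (fun s : R => s ^+ k.+1) (k.+1%:R * s ^+ k).
    by have := dirX _ k _ _ _ (is_derive_id s (1 : R)); rewrite mulr1.
  by have := dirM _ _ _ _ _ _ d1 (dir_cst (K ^+ 3) s 1); rewrite mulr0 addr0.
have := dirV (fun s => s ^+ k.+1 * K ^+ 3) s 1 _ h dp; congr is_derive.
have K3 : K != 0 by rewrite gt_eqF.
have sk : s ^+ k != 0 by rewrite expf_neq0.
by rewrite !exprS; field; rewrite s0 K3 sk.
Qed.

Lemma profile_derive s : 0 < s -> is_derive s 1 profile (profile' s).
Proof.
move=> s0; have := dirM _ _ _ _ _ _ (dZ 1 s) (dinv 0 s (lt0r_neq0 s0)).
rewrite /profile' /profile; under eq_fun do rewrite expr1.
by congr is_derive; field; rewrite !gt_eqF.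
Qed.

Lemma profile'_derive s : 0 < s -> is_derive s 1 profile' (profile'' s).
Proof.
move=> s0; have h := lt0r_neq0 s0.
have d1 := dirM _ _ _ _ _ _ (dir_cst 3 s 1) (dirM _ _ _ _ _ _ (dZ 0 s) (dinv 0 s h)).
have d2 := dirD _ _ _ _ _ _ d1 (dirM _ _ _ _ _ _ (dZ 1 s) (dinv 1 s h)).
have := dirB _ _ _ _ _ _ (dir_cst 0 s 1) d2.
rewrite (_ : (fun _ => _) = profile').
  by congr is_derive; rewrite /profile''; field; rewrite !gt_eqF.
by apply/funext => z; rewrite /profile' sub0r expr1 mulrA.
Qed.

Lemma profile''_continuous s : 0 < s -> {for s, continuous profile''}.
Proof.
move=> s0; have cZ : {for s, continuous Z}.
  apply: cont_max; last exact: cont_cst.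
  by apply: contB; [exact: cont_cst|exact: cont_id].
have ci k : {for s, continuous (fun s => (s ^+ k * K ^+ 3)^-1)}.
  apply: contV; first by rewrite mulf_neq0 ?expf_neq0// gt_eqF.
  by apply: contM; [apply: contX; exact: cont_id|exact: cont_cst].
have c1 := ci 1%N; rewrite /profile''; repeat apply: contD.
- by apply: contM; [apply: contM => //; exact: cont_cst|exact: c1].
- by apply: contM => //; apply: contM; [exact: cont_cst|exact: contX].
- by apply: contM => //; apply: contM; [exact: cont_cst|exact: contX].
Qed.

Lemma profile_ge0 s : 0 < s -> 0 <= profile s.
Proof. by move=> s0; rewrite divr_ge0 ?exprn_ge0// mulr_ge0 ?exprn_ge0// ltW. Qed.

Lemma profile'_le0 s : 0 < s -> profile' s <= 0.
Proof.
move=> s0; rewrite oppr_le0 addr_ge0// divr_ge0// ?mulr_ge0 ?exprn_ge0// ltW//.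
Qed.

Lemma profile_eq0 s : K <= s -> [/\ profile s = 0, profile' s = 0 & profile'' s = 0].
Proof.
move=> Ks; have Z0 : Z s = 0 by rewrite /Z max_r// subr_le0.
by rewrite /profile /profile' /profile'' Z0 !expr0n /= !mulr0 !mul0r !addr0 oppr0.
Qed.

(** If W satisfies W_t + div (a grad W) >= 2 a |grad W|^2 / W, the left-hand side is the factor
    of a |grad W|^2 that remains in the same expression for [profile] of W. It would be 0 for
    the function 1/s; the truncation makes it small when [K] is large. *)
Lemma profile_key s : 0 < s -> 2 * profile' s / s + profile'' s <= 6 / K / s ^+ 2.
Proof.
move=> s0.
have -> : 2 * profile' s / s + profile'' s = 6 * Z s / (s * K ^+ 3).
  by rewrite /profile' /profile''; field; rewrite !gt_eqF.
have [sK|Ks] := ltP s K; last first.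
  by rewrite /Z max_r ?subr_le0// mulr0 mul0r !divr_ge0// ?exprn_ge0// ltW.
have ZK : Z s <= K by rewrite /Z max_l ?subr_ge0 ?gerBl ltW.
rewrite -subr_ge0 (_ : _ - _ = 6 * (K ^+ 2 - s * Z s) / (s ^+ 2 * K ^+ 3)); last first.
  by field; rewrite !gt_eqF.
rewrite divr_ge0// ?mulr_ge0 ?exprn_ge0 ?(ltW s0) ?(ltW K0)// subr_ge0 expr2.
by apply: ler_pM => //; exact: ltW.
Qed.

Lemma profile_lower s : 0 < s -> 2 * s <= K -> (8 * s)^-1 <= profile s.
Proof.
move=> s0 sK; have ZE : K / 2 <= Z s by rewrite /Z max_l; lra.
apply: (@le_trans _ _ ((K / 2) ^+ 3 / (s * K ^+ 3))).
  by rewrite (_ : _ / _ = (8 * s)^-1)//; field; rewrite !gt_eqF.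
rewrite ler_wpM2r// ?invr_ge0 ?mulr_ge0 ?exprn_ge0 ?(ltW s0) ?(ltW K0)//.
by rewrite ler_pXn2r// nnegrE; lra.
Qed.

End cutoff_profile.

(** * The barrier *)

Lemma dir_coord {R : realType} {n} (i k : 'I_n) (x : 'rV[R]_n) :
  is_derive x (basis_vec R i) (fun z : 'rV[R]_n => z ord0 k) (k == i)%:R.
Proof.
apply/is_derive_line0.
have := dirD _ _ _ _ _ _ (dirM _ _ _ _ _ _ (is_derive_id (0 : R) (1 : R))
  (dir_cst ((k == i)%:R : R) (0 : R) (1 : R))) (dir_cst (x ord0 k) (0 : R) (1 : R)).
rewrite mulr0 addr0 addr0 mul1r; congr is_derive.
by apply/funext => s; rewrite !mxE eqxx.
Qed.

Lemma cont_coord {R : realType} {n} (k : 'I_n) (x : 'rV[R]_n) :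
  {for x, continuous (fun z : 'rV[R]_n => z ord0 k)}.
Proof. exact: coord_continuous. Qed.

Section barrier_sum.
Context {R : realType} {n : nat} {J : finType}.
Variables (y : J -> 'rV[R]_n) (m al S : R).
Implicit Types (x : 'rV[R]_n) (t : R) (i : 'I_n) (j : J).

Let sg t := al / (S - t).
Let pw (e : R) j x := sqdist x (y j) `^ e.
Let del i j x := 2 * (x ord0 i - y j ord0 i).

(** The barrier is the sum W of the exponentials [barrier_term]; the letters [exponent] refer to
    the function in the exponent and its derivatives. Only 1/W is used as a weight, but the
    sum is the convenient expression to differentiate. *)
Definition barrier_term j x t := expR (sg t * pw m j x).
Definition exponent_x i j x t := sg t * (m * pw (m - 1) j x * del i j x).
Definition exponent_xx i j x t := sg t * (m * ((m - 1) * pw (m - 1 - 1) j x * del i j x * del i j x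
  + pw (m - 1) j x * 2)).
Definition exponent_t j x t := al / (S - t) ^+ 2 * pw m j x.

Definition barrier x t := \sum_j barrier_term j x t.
Definition barrier_x i x t := \sum_j barrier_term j x t * exponent_x i j x t.
Definition barrier_xx i x t := \sum_j barrier_term j x t * (exponent_x i j x t ^+ 2 + exponent_xx i j x t).
Definition barrier_t x t := \sum_j barrier_term j x t * exponent_t j x t.

Let d_sqd i j x : is_derive x (basis_vec R i) (fun z => sqdist z (y j)) (del i j x).
Proof.
have -> : del i j x = \sum_(k < n) 2%:R * (x ord0 k - y j ord0 k) ^+ 1 * ((k == i)%:R - 0).
  rewrite (bigD1 i)//= eqxx big1 => [|k /negPf ->]; last by rewrite subrr mulr0.
  by rewrite addr0 subr0 mulr1 expr1.
apply: dir_sum => k.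
exact: (dirX _ 1 _ _ _ (dirB _ _ _ _ _ _ (dir_coord i k x) (dir_cst (y j ord0 k) x (basis_vec R i)))).
Qed.

Let d_pw e i j x : 0 < sqdist x (y j) ->
  is_derive x (basis_vec R i) (pw e j) (e * pw (e - 1) j x * del i j x).
Proof.
move=> x0.
exact: (dir_comp (fun q => q `^ e) (fun z => sqdist z (y j)) x _ _ _ (is_derive1_powR e x0) (d_sqd i j x)).
Qed.

Let d_del i j x : is_derive x (basis_vec R i) (del i j) 2.
Proof.
have := dirM _ _ _ _ _ _ (dir_cst 2 x (basis_vec R i)) (dirB _ _ _ _ _ _ (dir_coord i i x) (dir_cst (y j ord0 i) x (basis_vec R i))).
by rewrite eqxx mul0r add0r subr0 mulr1.
Qed.

Let d_barrier_term i j x t : 0 < sqdist x (y j) ->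
  is_derive x (basis_vec R i) (barrier_term j ^~ t) (barrier_term j x t * exponent_x i j x t).
Proof.
move=> x0; have h := dirM _ _ _ _ _ _ (dir_cst (sg t) x (basis_vec R i)) (d_pw m i j x x0).
have := dir_comp expR (fun z => sg t * pw m j z) x _ _ _ (is_derive_expR _) h.
by rewrite mul0r add0r.
Qed.

Let d_exponent_x i j x t : 0 < sqdist x (y j) ->
  is_derive x (basis_vec R i) (exponent_x i j ^~ t) (exponent_xx i j x t).
Proof.
move=> x0.
have h1 := dirM _ _ _ _ _ _ (dir_cst m x (basis_vec R i)) (d_pw (m - 1) i j x x0).
have h2 := dirM _ _ _ _ _ _ h1 (d_del i j x).
have := dirM _ _ _ _ _ _ (dir_cst (sg t) x (basis_vec R i)) h2.
by congr is_derive; rewrite /exponent_xx; ring.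
Qed.

Lemma barrier_derive i x t : (forall j, 0 < sqdist x (y j)) ->
  is_derive x (basis_vec R i) (barrier ^~ t) (barrier_x i x t).
Proof. by move=> x0; apply: dir_sum => j; exact: d_barrier_term. Qed.

Lemma barrier_x_derive i x t : (forall j, 0 < sqdist x (y j)) ->
  is_derive x (basis_vec R i) (barrier_x i ^~ t) (barrier_xx i x t).
Proof.
move=> x0; apply: dir_sum => j.
have := dirM _ _ _ _ _ _ (d_barrier_term i j x t (x0 j)) (d_exponent_x i j x t (x0 j)).
by congr is_derive; ring.
Qed.

Lemma barrier_t_derive x t : t < S -> is_derive t 1 (barrier x) (barrier_t x t).
Proof.
move=> tS; have St : S - t != 0 by rewrite gt_eqF// subr_gt0.
apply: dir_sum => j.
have h1 := dirV (fun t => S - t) t 1 _ St (dirB _ _ _ _ _ _ (dir_cst S t 1) (is_derive_id t (1 : R))).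
have h2 := dirM _ _ _ _ _ _ (dirM _ _ _ _ _ _ (dir_cst al t 1) h1) (dir_cst (pw m j x) t 1).
have := dir_comp expR (fun t => sg t * pw m j x) t 1 _ _ (is_derive_expR _) h2.
by congr is_derive; rewrite /exponent_t /barrier_term /sg; field.
Qed.

Section continuity.
Variables (x : 'rV[R]_n) (t : R).
Hypotheses (x0 : forall j, 0 < sqdist x (y j)) (tS : t < S).

Let c_sg : {for (x, t), continuous (fun p : 'rV[R]_n * R => sg p.2)}.
Proof.
apply: contM; first exact: cont_cst.
apply: contV; first by rewrite gt_eqF//= subr_gt0.
by apply: contB; [exact: cont_cst|exact: cvg_snd].
Qed.

Let c_coord k : {for (x, t), continuous (fun p : 'rV[R]_n * R => p.1 ord0 k)}.
Proof.
apply: (@continuous_comp _ _ _ fst (fun z : 'rV[R]_n => z ord0 k)); first exact: cvg_fst.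
exact: cont_coord.
Qed.

Let c_del i j : {for (x, t), continuous (fun p : 'rV[R]_n * R => del i j p.1)}.
Proof.
apply: contM; first exact: cont_cst.
by apply: contB; [exact: c_coord|exact: cont_cst].
Qed.

Let c_pw e j : {for (x, t), continuous (fun p : 'rV[R]_n * R => pw e j p.1)}.
Proof.
apply: (cont_comp (fun q => q `^ e) (fun p : 'rV[R]_n * R => sqdist p.1 (y j))).
  apply/differentiable_continuous/derivable1_diffP.
  by have [] := is_derive1_powR e (x0 j).
apply: cont_sum => k; apply: contX; apply: contB; last exact: cont_cst.
exact: c_coord.
Qed.

Let c_barrier_term j : {for (x, t), continuous (fun p : 'rV[R]_n * R => barrier_term j p.1 p.2)}.
Proof.
by apply: (cont_comp expR); [exact: continuous_expR|apply: contM => //].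
Qed.

Let c_exponent_x i j : {for (x, t), continuous (fun p : 'rV[R]_n * R => exponent_x i j p.1 p.2)}.
Proof.
apply: contM => //; apply: contM => //; apply: contM => //; exact: cont_cst.
Qed.

Lemma barrier_continuous : {for (x, t), continuous (fun p : 'rV[R]_n * R => barrier p.1 p.2)}.
Proof. by apply: cont_sum => j. Qed.

Lemma barrier_x_continuous i :
  {for (x, t), continuous (fun p : 'rV[R]_n * R => barrier_x i p.1 p.2)}.
Proof. by apply: cont_sum => j; exact: contM. Qed.

Lemma barrier_xx_continuous i :
  {for (x, t), continuous (fun p : 'rV[R]_n * R => barrier_xx i p.1 p.2)}.
Proof.
apply: cont_sum => j; apply: contM => //; apply: contD; first exact: contX.
apply: contM => //; apply: contM; first exact: cont_cst.
apply: contD.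
  by apply: contM => //; apply: contM => //; apply: contM => //; exact: cont_cst.
by apply: contM => //; exact: cont_cst.
Qed.

Lemma barrier_t_continuous :
  {for (x, t), continuous (fun p : 'rV[R]_n * R => barrier_t p.1 p.2)}.
Proof.
apply: cont_sum => j; apply: contM => //; apply: contM => //.
apply: contM; first exact: cont_cst.
apply: contV; first by rewrite expf_neq0// gt_eqF//= subr_gt0.
by apply: contX; apply: contB; [exact: cont_cst|exact: cvg_snd].
Qed.

End continuity.

Lemma barrier_term_gt0 j x t : 0 < barrier_term j x t.
Proof. exact: expR_gt0. Qed.

Lemma barrier_ge_term j x t : barrier_term j x t <= barrier x t.
Proof. by rewrite /barrier (bigD1 j)//= lerDl sumr_ge0// => k _; rewrite ltW ?barrier_term_gt0. Qed.

End barrier_sum.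

(** * The differential inequality for the barrier *)

Lemma powRB_gt0 {R : realType} (x r s : R) : 0 < x -> x `^ (r - s) = x `^ r / x `^ s.
Proof. by move=> x0; rewrite powRB//; apply/implyP => _; rewrite gt_eqF. Qed.

(** Here [P] is q^m, [s] is 1/(S - t), [z] and [h] are the first and second derivatives of the
    exponent al s q^m in space, and al s^2 P is its time derivative. The time derivative
    absorbs the quadratic term on the left because al is small, and the terms with [dA] and
    [h], which are only of order al s, because s P is large. *)
Lemma barrier_term_ineq {R : realType} {n : nat} (q P s m al c0 c1 A : R)
    (u dA z h : 'I_n -> R) :
  0 < q -> 0 < P -> 0 < s -> m < 0 -> 0 < al -> 0 <= c0 -> 0 <= c1 ->
  \sum_i u i ^+ 2 = q -> 0 <= A -> A <= c0 * (q / P) ->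
  \sum_i dA i ^+ 2 <= (c1 / P) ^+ 2 * q ->
  8 * al * c0 * m ^+ 2 <= 1 ->
  2 * (- m * (2 * c1 + c0 * (4 * (1 - m) + 2 * n%:R))) <= s * P ->
  (forall i, z i = al * s * (m * (P / q) * (2 * u i))) ->
  (forall i, h i =
    al * s * (m * ((m - 1) * (P / q / q) * (2 * u i) * (2 * u i) + P / q * 2))) ->
  A * \sum_i z i ^+ 2 <= al * s ^+ 2 * P + \sum_i (dA i * z i + A * h i).
Proof.
move=> q0 P0 s0 m0 al0 c00 c10 uq A0 AP dAP al8 B zE hE.
have sz : \sum_i z i ^+ 2 = 4 * (al * s) ^+ 2 * m ^+ 2 * (P ^+ 2 / q).
  rewrite (eq_bigr (fun i => (4 * (al * s) ^+ 2 * m ^+ 2 * (P / q) ^+ 2) * u i ^+ 2)); last first.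
    by move=> i _; rewrite zE; ring.
  by rewrite -mulr_sumr uq; field; rewrite gt_eqF.
have sh : \sum_i h i = al * s * m * (P / q) * (4 * (m - 1) + 2 * n%:R).
  rewrite (eq_bigr (fun i => (al * s * m * (m - 1) * (P / q / q) * 4) * u i ^+ 2 +
    al * s * m * (P / q) * 2)); last by move=> i _; rewrite hE; ring.
  rewrite big_split /= -mulr_sumr uq sumr_const card_ord -[X in _ + X]mulr_natl.
  by field; rewrite gt_eqF.
pose X := \sum_i dA i * u i.
have sd : \sum_i dA i * z i = 2 * (al * s) * m * (P / q) * X.
  by rewrite /X mulr_sumr; apply: eq_bigr => i _; rewrite zE; ring.
have r0 : 0 < P / q by rewrite divr_gt0.
have X2 : X ^+ 2 <= (c1 / P * q) ^+ 2.
  have E (f : 'I_n -> R) : \sum_i 1 * f i = \sum_i f i.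
    by apply: eq_bigr => i _; rewrite mul1r.
  have := cauchy_schwarz _ (fun=> 1) dA u (fun=> ler01); rewrite !E uq -/X => /le_trans; apply.
  rewrite exprMn [X in _ <= _ * X]expr2 mulrA; apply: ler_wpM2r; first exact: ltW.
  exact: dAP.
have Xle : X <= c1 / P * q.
  apply: le_trans (ler_norm _) _; rewrite -(ler_pXn2r (ltn0Sn 1)) ?nnegrE//.
    by rewrite real_normK ?num_real.
  by rewrite mulr_ge0 ?divr_ge0// ltW.
have p0 : 0 < al * s by rewrite mulr_gt0.
have AP' : A * (P / q) <= c0.
  apply: le_trans (ler_wpM2r (ltW r0) AP) _.
  by rewrite (_ : c0 * _ * _ = c0)//; field; rewrite !gt_eqF.
rewrite big_split /= -mulr_sumr sd sh sz.
have T1 : 2 * (al * s) * m * c1 <= 2 * (al * s) * m * (P / q) * X.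
  rewrite -subr_ge0 (_ : _ - _ = 2 * (al * s) * (- m) * (P / q) * (c1 / P * q - X)).
    have nm : 0 <= - m by rewrite oppr_ge0 ltW.
    have X0 : 0 <= c1 / P * q - X by rewrite subr_ge0.
    by rewrite mulr_ge0// mulr_ge0 ?(ltW r0)// mulr_ge0// mulr_ge0// ltW.
  by field; rewrite !gt_eqF.
have T2 : al * s * m * c0 * (4 * (1 - m) + 2 * n%:R) <=
    A * (al * s * m * (P / q) * (4 * (m - 1) + 2 * n%:R)).
  set Y := 4 * (1 - m) + 2 * n%:R; set Y' := 4 * (m - 1) + _.
  have n0 : 0 <= n%:R :> R by [].
  have Y0 : 0 <= Y by rewrite /Y; lra.
  have YY : Y' <= Y by rewrite /Y /Y'; lra.
  rewrite -subr_ge0 (_ : _ - _ = al * s * (- m) * ((c0 - A * (P / q)) * Y + A * (P / q) * (Y - Y'))); last by ring.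
  have nm : 0 <= - m by rewrite oppr_ge0 ltW.
  have AP0 : 0 <= A * (P / q) by rewrite mulr_ge0// ltW.
  rewrite mulr_ge0//; first by rewrite mulr_ge0// ltW.
  by rewrite addr_ge0// mulr_ge0// subr_ge0.
have T3 : A * (4 * (al * s) ^+ 2 * m ^+ 2 * (P ^+ 2 / q)) <= al * s ^+ 2 * P / 2.
  rewrite (_ : A * _ = (A * (P / q)) * (4 * (al * s) ^+ 2 * m ^+ 2 * P)); last first.
    by field; rewrite gt_eqF.
  apply: (@le_trans _ _ (c0 * (4 * (al * s) ^+ 2 * m ^+ 2 * P))).
    apply: ler_wpM2r => //; rewrite mulr_ge0 ?(ltW P0)// mulr_ge0 ?sqr_ge0//.
    by rewrite mulr_ge0 ?sqr_ge0.
  rewrite -subr_ge0 (_ : _ - _ = al * s ^+ 2 * P / 2 * (1 - 8 * al * c0 * m ^+ 2)); last by field.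
  rewrite mulr_ge0 ?subr_ge0// divr_ge0// mulr_ge0 ?(ltW P0)// mulr_ge0 ?sqr_ge0//.
  exact: ltW.
have T4 : 0 <= al * s * (s * P / 2 - - m * (2 * c1 + c0 * (4 * (1 - m) + 2 * n%:R))).
  by rewrite mulr_ge0 ?(ltW p0)// subr_ge0; lra.
move: T1 T2 T3 T4; set M := 4 * (1 - m) + 2 * n%:R => T1 T2 T3 T4.
have -> : al * s ^+ 2 * P = al * s ^+ 2 * P / 2 + al * s * (s * P / 2 - - m * (2 * c1 + c0 * M)) -
   (2 * (al * s) * m * c1 + al * s * m * c0 * M) by field.
lra.
Qed.

Section barrier_inequality.
Context {R : realType} {n : nat} {J : finType}.
Variables (y : J -> 'rV[R]_n) (m al S : R) (x : 'rV[R]_n) (t : R).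
Variables (j0 : J) (c0 A : R).
Hypotheses (x0 : forall j, 0 < sqdist x (y j)) (tS : t < S) (m0 : m < 0) (al0 : 0 < al).
Hypotheses (c00 : 0 <= c0) (A0 : 0 <= A) (Ac : forall j, A <= c0 * sqdist x (y j) `^ (1 - m)).

Let pwB (e : R) j : sqdist x (y j) `^ (e - 1) = sqdist x (y j) `^ e / sqdist x (y j).
Proof. by rewrite powRB_gt0// powRr1// ltW. Qed.

Let pwV j : sqdist x (y j) `^ (1 - m) = sqdist x (y j) / sqdist x (y j) `^ m.
Proof. by rewrite powRB_gt0// powRr1// ltW. Qed.

Lemma barrier_gt0 : 0 < barrier y m al S x t.
Proof. exact: lt_le_trans (barrier_term_gt0 _ _ _ _ j0 _ _) (barrier_ge_term _ _ _ _ _ _ _). Qed.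

Let barrier_x_sqr i : barrier_x y m al S i x t ^+ 2 <=
  barrier y m al S x t * \sum_j barrier_term y m al S j x t * exponent_x y m al S i j x t ^+ 2.
Proof.
have := cauchy_schwarz _ (barrier_term y m al S ^~ x ^~ t) (fun=> 1)
  (fun j => exponent_x y m al S i j x t) (fun j => ltW (barrier_term_gt0 _ _ _ _ _ _ _)).
rewrite (eq_bigr (fun j => barrier_term y m al S j x t * exponent_x y m al S i j x t)).
  rewrite [X in _ <= X * _](eq_bigr (fun j => barrier_term y m al S j x t))//.
  by move=> j _; rewrite expr1n mulr1.
by move=> j _; rewrite mul1r.
Qed.

Let grad_le : \sum_i barrier_x y m al S i x t ^+ 2 <=
  barrier y m al S x t * \sum_j barrier_term y m al S j x t * \sum_i exponent_x y m al S i j x t ^+ 2.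
Proof.
apply: (@le_trans _ _ (\sum_i barrier y m al S x t *
    \sum_j barrier_term y m al S j x t * exponent_x y m al S i j x t ^+ 2)).
  by apply: ler_sum => i _; exact: barrier_x_sqr.
rewrite -mulr_sumr exchange_big /= le_eqVlt; apply/orP; left; apply/eqP.
by congr (_ * _); apply: eq_bigr => j _; rewrite mulr_sumr.
Qed.

(** This expresses that the reciprocal of the barrier is a supersolution. On the right-hand side
    the squared gradients of the exponents are summed with the weights [barrier_term], on the
    left-hand side the gradient of the sum is squared: the Cauchy-Schwarz inequality compares
    them in the right direction. *)
Lemma barrier_supersol (dA : 'I_n -> R) (c1 : R) : 0 <= c1 ->
  (forall j, \sum_i dA i ^+ 2 <= (c1 * sqdist x (y j) `^ (2^-1 - m)) ^+ 2) ->
  8 * al * c0 * m ^+ 2 <= 1 ->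
  (forall j, 2 * (- m * (2 * c1 + c0 * (4 * (1 - m) + 2 * n%:R))) <=
     (S - t)^-1 * sqdist x (y j) `^ m) ->
  2 * (A * \sum_i barrier_x y m al S i x t ^+ 2) / barrier y m al S x t <=
  barrier_t y m al S x t +
    \sum_i (dA i * barrier_x y m al S i x t + A * barrier_xx y m al S i x t).
Proof.
move=> c10 dAc al8 B; set W := barrier y m al S x t; have W0 : 0 < W := barrier_gt0.
have h1 : A * (\sum_i barrier_x y m al S i x t ^+ 2) / W <=
    A * \sum_j barrier_term y m al S j x t * \sum_i exponent_x y m al S i j x t ^+ 2.
  by rewrite -mulrA ler_wpM2l// ler_pdivrMr// [leRHS]mulrC; exact: grad_le.
rewrite -mulrA; apply: (@le_trans _ _ (2 * (A * \sum_j barrier_term y m al S j x t *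
    \sum_i exponent_x y m al S i j x t ^+ 2))); first by rewrite ler_pM2l.
have -> : barrier_t y m al S x t + \sum_i (dA i * barrier_x y m al S i x t + A * barrier_xx y m al S i x t) =
  \sum_j barrier_term y m al S j x t * (exponent_t y m al S j x t + \sum_i (dA i * exponent_x y m al S i j x t +
     A * (exponent_x y m al S i j x t ^+ 2 + exponent_xx y m al S i j x t))).
  under [RHS]eq_bigr do rewrite mulrDr mulr_sumr.
  rewrite [RHS]big_split /= [X in _ = _ + X]exchange_big /=; congr (_ + _).
  apply: eq_bigr => i _.
  rewrite /barrier_x /barrier_xx !mulr_sumr -big_split; apply: eq_bigr => j _ /=; ring.
rewrite !mulr_sumr; apply: ler_sum => j _.
rewrite (_ : 2 * (A * _) = barrier_term y m al S j x t * (2 * (A * \sum_i exponent_x y m al S i j x t ^+ 2))); last by ring.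
rewrite ler_pM2l ?barrier_term_gt0//.
have q0 := x0 j; have P0 : 0 < sqdist x (y j) `^ m by rewrite powR_gt0.
have s0 : 0 < (S - t)^-1 by rewrite invr_gt0 subr_gt0.
have a1 : A <= c0 * (sqdist x (y j) / sqdist x (y j) `^ m) by rewrite -pwV.
have a2 : \sum_i dA i ^+ 2 <= (c1 / sqdist x (y j) `^ m) ^+ 2 * sqdist x (y j).
  apply: le_trans (dAc j) _; rewrite powRB_gt0// powR12_sqrt ?(ltW q0)//.
  set P := sqdist x (y j) `^ m; rewrite [leLHS](_ : _ = (c1 / P) ^+ 2 * Num.sqrt (sqdist x (y j)) ^+ 2).
    by rewrite sqr_sqrtr// ltW.
  by rewrite -exprMn; congr (_ ^+ 2); ring.
have g1 i : exponent_x y m al S i j x t = al * (S - t)^-1 *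
   (m * (sqdist x (y j) `^ m / sqdist x (y j)) * (2 * (x ord0 i - y j ord0 i))).
  by rewrite /exponent_x pwB.
have g2 i : exponent_xx y m al S i j x t = al * (S - t)^-1 *
   (m * ((m - 1) * (sqdist x (y j) `^ m / sqdist x (y j) / sqdist x (y j)) *
      (2 * (x ord0 i - y j ord0 i)) * (2 * (x ord0 i - y j ord0 i)) +
      sqdist x (y j) `^ m / sqdist x (y j) * 2)).
  by rewrite /exponent_xx !pwB.
have h := @barrier_term_ineq R n (sqdist x (y j)) (sqdist x (y j) `^ m) (S - t)^-1 m al c0 c1 A
  _ dA _ _ q0 P0 s0 m0 al0 c00 c10 erefl A0 a1 a2 al8 (B j) g1 g2.
rewrite mulrDl mul1r.
have -> : \sum_i (dA i * exponent_x y m al S i j x t +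
     A * (exponent_x y m al S i j x t ^+ 2 + exponent_xx y m al S i j x t)) =
  \sum_i (dA i * exponent_x y m al S i j x t + A * exponent_xx y m al S i j x t) +
  A * \sum_i exponent_x y m al S i j x t ^+ 2.
  by rewrite mulr_sumr -big_split; apply: eq_bigr => i _ /=; ring.
rewrite addrA lerD2r; apply: le_trans h _; by rewrite lerD2r /exponent_t exprVn.
Qed.

(** The square of the gradient of each exponent is a multiple of q^(2 m - 1), which the bound on
    [A] turns into q^m. *)
Lemma barrier_grad_le (Q : R) : (forall j, sqdist x (y j) `^ m <= Q) ->
  A * \sum_i barrier_x y m al S i x t ^+ 2 <=
  4 * c0 * (al / (S - t)) ^+ 2 * m ^+ 2 * Q * barrier y m al S x t ^+ 2.
Proof.
move=> hQ; set W := barrier y m al S x t; have W0 : 0 < W := barrier_gt0.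
apply: (@le_trans _ _ (A * (W * \sum_j barrier_term y m al S j x t * \sum_i exponent_x y m al S i j x t ^+ 2))).
  by rewrite ler_wpM2l//; exact: grad_le.
rewrite expr2 mulrCA [leRHS]mulrCA; apply: ler_wpM2l; first exact: ltW.
rewrite mulr_sumr /W /barrier [leRHS]mulr_sumr; apply: ler_sum => j _.
rewrite mulrCA [leRHS]mulrC; apply: ler_wpM2l; first by rewrite ltW ?barrier_term_gt0.
have q0 := x0 j; have P0 : 0 < sqdist x (y j) `^ m by rewrite powR_gt0.
have -> : \sum_i exponent_x y m al S i j x t ^+ 2 =
   4 * (al / (S - t)) ^+ 2 * m ^+ 2 * (sqdist x (y j) `^ m) ^+ 2 / sqdist x (y j).
  rewrite (eq_bigr (fun i => (4 * (al / (S - t)) ^+ 2 * m ^+ 2 * (sqdist x (y j) `^ m / sqdist x (y j)) ^+ 2) *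
     (x ord0 i - y j ord0 i) ^+ 2)); last by move=> i _; rewrite /exponent_x pwB; ring.
  by rewrite -mulr_sumr -/(sqdist x (y j)); field; rewrite !gt_eqF// subr_gt0.
have h : A * (sqdist x (y j) `^ m / sqdist x (y j)) <= c0.
  apply: le_trans (ler_wpM2r _ (Ac j)) _; first by rewrite divr_ge0// ltW.
  by rewrite pwV (_ : c0 * _ * _ = c0)//; field; rewrite !gt_eqF.
rewrite (_ : A * _ = (4 * (al / (S - t)) ^+ 2 * m ^+ 2) *
  ((A * (sqdist x (y j) `^ m / sqdist x (y j))) * sqdist x (y j) `^ m)); last by field; rewrite !gt_eqF ?subr_gt0.
rewrite (_ : 4 * c0 * _ * _ * _ = (4 * (al / (S - t)) ^+ 2 * m ^+ 2) * (c0 * Q)); last by ring.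
apply: ler_wpM2l; first by rewrite mulr_ge0 ?sqr_ge0// mulr_ge0 ?sqr_ge0.
apply: ler_pM => //; last exact: ltW.
by rewrite mulr_ge0// divr_ge0// ltW.
Qed.

End barrier_inequality.

(** * Energy inequality at a fixed time *)

Lemma supp_in_closed {R : realType} {n : nat} (C : set 'rV[R]_n) (L : R) (f : 'rV[R]_n -> R) :
  (forall x, C x -> `|x| <= L) -> (forall x, ~ C x -> f x = 0) -> supp_in L f.
Proof. by move=> CL f0 x Lx; apply: f0 => /CL; rewrite leNgt Lx. Qed.

Definition cont_on {R : realType} {n : nat} (O : set 'rV[R]_n) (f : 'rV[R]_n -> R) :=
  forall x, O x -> {for x, continuous f}.

Definition partials_on {R : realType} {n : nat} (O : set 'rV[R]_n) (f : 'rV[R]_n -> R)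
    (df : 'I_n -> 'rV[R]_n -> R) :=
  forall i x, O x -> is_derive x (basis_vec R i) f (df i x).

Section energy.
Context {R : realType} {n : nat}.
Variables (Omega C C2 : set 'rV[R]_n) (L M : R).
Hypotheses (oO : open Omega) (cC : closed C) (CO : C `<=` Omega).
Hypotheses (cC2 : closed C2) (C2O : C2 `<=` Omega).
Hypotheses (CL : forall x, C x -> `|x| <= L) (C2L : forall x, C2 x -> `|x| <= L).
Variables (U A Ut phi phit psi : 'rV[R]_n -> R) (dU dA ddU dphi ddphi : 'I_n -> 'rV[R]_n -> R).

Local Notation contO := (cont_on Omega).
Local Notation dirO := (partials_on Omega).

Hypotheses (cU : contO U) (cA : contO A) (cUt : contO Ut) (cdU : forall i, contO (dU i))
  (cdA : forall i, contO (dA i)) (cddU : forall i, contO (ddU i)).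
Hypotheses (cphi : contO phi) (cphit : contO phit) (cdphi : forall i, contO (dphi i))
  (cddphi : forall i, contO (ddphi i)) (cpsi : contO psi).
Hypotheses (DU : dirO U dU) (DA : dirO A dA)
  (DdU : forall i x, Omega x -> is_derive x (basis_vec R i) (dU i) (ddU i x)).
Hypotheses (Dphi : dirO phi dphi)
  (Ddphi : forall i x, Omega x -> is_derive x (basis_vec R i) (dphi i) (ddphi i x)).
Hypotheses (sphi : forall x, ~ C x -> phi x = 0) (sphit : forall x, ~ C x -> phit x = 0)
  (sdphi : forall i x, ~ C x -> dphi i x = 0) (sddphi : forall i x, ~ C x -> ddphi i x = 0)
  (spsi : forall x, ~ C2 x -> psi x = 0).
Hypotheses (phi0 : forall x, 0 <= phi x) (A0 : forall x, Omega x -> 0 <= A x).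
Hypothesis (UtE : forall x, Omega x -> Ut x = \sum_i (dA i x * dU i x + A x * ddU i x)).
Hypothesis (key : forall x, Omega x ->
  phit x + \sum_i (dA i x * dphi i x + A x * ddphi i x) <= M * psi x).

Let csupp (f : 'rV[R]_n -> R) (B : set 'rV[R]_n) : closed B -> B `<=` Omega ->
  contO f -> (forall x, ~ B x -> f x = 0) -> continuous f.
Proof. by move=> cB BO cf f0; exact: (cont_supp Omega B f f oO cB BO _ f0 cf). Qed.

Let c1 f (F : R -> R) : contO f -> continuous F -> contO (fun x => F (f x)).
Proof. by move=> cf cF x Ox; apply: cont_comp; [exact: cF|exact: cf]. Qed.

Let G i x := phi x * A x * (smooth_abs' (U x) * dU i x) - smooth_abs (U x) * (A x * dphi i x).

Let dG i x :=
  phi x * (A x * (smooth_abs'' (U x) * dU i x ^+ 2)) +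
  phi x * (smooth_abs' (U x) * (dA i x * dU i x + A x * ddU i x)) -
  smooth_abs (U x) * (dA i x * dphi i x + A x * ddphi i x).

Let sG i x : ~ C x -> G i x = 0.
Proof. by move=> Cx; rewrite /G sphi// sdphi// !mul0r !mulr0 subrr. Qed.

Let sdG i x : ~ C x -> dG i x = 0.
Proof.
move=> Cx; rewrite /dG sphi// sdphi// sddphi//.
by rewrite !mul0r !mulr0 !addr0 mulr0 subrr.
Qed.

Let cdG i : continuous (dG i).
Proof.
apply: (csupp _ C) => //; last exact: sdG.
move=> x Ox; apply: contB; first apply: contD.
- apply: contM; first exact: cphi.
  apply: contM; first exact: cA.
  by apply: contM; [exact: c1 smooth_abs''_continuous _ _|apply: contX; exact: cdU].
- apply: contM; first exact: cphi.
  apply: contM; first exact: c1 smooth_abs'_continuous _ _.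
  by apply: contD; apply: contM; [exact: cdA|exact: cdU|exact: cA|exact: cddU].
- apply: contM; first exact: c1 smooth_abs_continuous _ _.
  by apply: contD; apply: contM; [exact: cdA|exact: cdphi|exact: cA|exact: cddphi].
Qed.

Let DG i x : is_derive x (basis_vec R i) (G i) (dG i x).
Proof.
apply: (dir_supp Omega C (G i) (G i) (dG i) (dG i) _ oO cC CO) => //.
- exact: sG.
- exact: sdG.
move=> {}x Ox.
have d1 := dir_comp smooth_abs' U x _ _ _ (smooth_abs'_derive (U x)) (DU i x Ox).
have d2 := dirM _ _ _ _ _ _ (dirM _ _ _ _ _ _ (Dphi i x Ox) (DA i x Ox))
  (dirM _ _ _ _ _ _ d1 (DdU i x Ox)).
have d3 := dir_comp smooth_abs U x _ _ _ (smooth_abs_derive (U x)) (DU i x Ox).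
have d4 := dirM _ _ _ _ _ _ d3 (dirM _ _ _ _ _ _ (DA i x Ox) (Ddphi i x Ox)).
have := dirB _ _ _ _ _ _ d2 d4.
by congr is_derive; rewrite /dG; ring.
Qed.

Let cintG i : integral_Rn (dG i) = 0.
Proof.
apply: (integral_Rn_partial0 i L (G i) (dG i) (DG i) (@cdG i)).
- by apply: (supp_in_closed C L) => // x; exact: sG.
- by apply: (supp_in_closed C L) => // x; exact: sdG.
Qed.

Let f x := phi x * smooth_abs' (U x) * Ut x + smooth_abs (U x) * phit x.
Let g x := smooth_abs (U x) * psi x.

Lemma energy_continuous : continuous f /\ supp_in L f.
Proof.
have s0 x : ~ C x -> f x = 0 by move=> Cx; rewrite /f sphi// sphit// !mul0r mulr0 addr0.
split; last exact: (supp_in_closed C L).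
apply: (csupp _ C) => // x Ox; apply: contD; apply: contM.
- by apply: contM; [exact: cphi|exact: c1 smooth_abs'_continuous _ _].
- exact: cUt.
- exact: c1 smooth_abs_continuous _ _.
- exact: cphit.
Qed.

(** Kato's inequality at a fixed time, tested with [phi]. The field
    G = phi A beta'(U) grad U - beta(U) A grad phi has compact support, hence a divergence of
    integral zero. In this divergence the mixed terms beta'(U) A grad U . grad phi cancel, and
    phi A beta''(U) |grad U|^2 is nonnegative by convexity and can be dropped. *)
Lemma energy_ineq : integral_Rn f <= M * integral_Rn g.
Proof.
have [cf sf] := energy_continuous.
have sg0 x : ~ C2 x -> g x = 0 by move=> Cx; rewrite /g spsi// mulr0.
have sg : supp_in L g by exact: (supp_in_closed C2 L).
have cg : continuous g.
  apply: (csupp _ C2) => // x Ox; apply: contM; last exact: cpsi.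
  exact: c1 smooth_abs_continuous _ _.
have cS : continuous (fun x => \sum_i dG i x).
  by move=> x; refine (cont_sum _ _ _ x _) => i; exact: cdG.
have sdGL i : supp_in L (dG i) by apply: (supp_in_closed C L) => // x; exact: sdG.
have sS : supp_in L (fun x => \sum_i dG i x).
  by move=> x Lx; rewrite big1// => i _; exact: sdGL.
have cMg : continuous (fun x => M * g x).
  by move=> x; refine (contM _ _ x _ _); [exact: cont_cst|exact: cg].
have sMg : supp_in L (fun x => M * g x) by move=> x Lx; rewrite sg// mulr0.
have -> : M * integral_Rn g = integral_Rn (fun x => \sum_i dG i x + M * g x).
  by rewrite (integral_RnD L)// (integral_Rn_sum L n dG cdG sdGL) (integral_RnZ L)// big1 ?add0r//.
apply: (le_integral_Rn L) => //.
- by move=> x; refine (contD _ _ x _ _); [exact: cS|exact: cMg].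
- by move=> x Lx; rewrite sS// sMg// addr0.
move=> x; have [Ox|nOx] := pselect (Omega x); last first.
  have nC : ~ C x by move=> /CO.
  have nC2 : ~ C2 x by move=> /C2O.
  by rewrite /f sphi// sphit// sg0// big1 => [|i _]; rewrite ?sdG// !mul0r !mulr0 addr0.
have -> : \sum_i dG i x = phi x * A x * smooth_abs'' (U x) * (\sum_i dU i x ^+ 2) +
   phi x * smooth_abs' (U x) * Ut x -
   smooth_abs (U x) * \sum_i (dA i x * dphi i x + A x * ddphi i x).
  rewrite UtE// !mulr_sumr -big_split -sumrB; apply: eq_bigr => i _ /=.
  by rewrite /dG; ring.
rewrite /f /g; have k := key x Ox; have b0 := smooth_abs_ge0 (U x).
have h1 : smooth_abs (U x) * (phit x + \sum_i (dA i x * dphi i x + A x * ddphi i x)) <=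
  smooth_abs (U x) * (M * psi x) by exact: ler_wpM2l.
have h2 : 0 <= phi x * A x * smooth_abs'' (U x) * (\sum_i dU i x ^+ 2).
  by rewrite mulr_ge0 ?mulr_ge0 ?smooth_abs''_ge0 ?A0// sumr_ge0// => i _; exact: sqr_ge0.
move: h1 h2; rewrite mulrDr (mulrCA M).
set a1 := _ * phit x; set a2 := _ * \sum_i _; set a3 := _ * (M * _); set a4 := _ * \sum_i _.
lra.
Qed.

End energy.

(** * Parabolic regularity on closed time slabs, and the test function *)

Lemma cont_within_comp {S T U : topologicalType} (A : set T) (f : T -> U) (g : S -> T) z :
  {within A, continuous f} -> {for z, continuous g} -> (\near z, A (g z)) ->
  {for z, continuous (fun s => f (g s))}.
Proof.
move=> /subspace_continuousP cf cg nA.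
have := cf _ (nbhs_singleton nA) => cfz P /cfz; rewrite /= /within /= => h.
have := cg _ h; rewrite /nbhs /= => h'.
by near=> s; (have : A (g s) -> P (f (g s)) by near: s); apply; near: s.
Unshelve. all: by end_near. Qed.

(** Freezing the time outside of [p, q] turns continuity relative to a closed time slab into
    continuity for all times. *)
Definition clamp {R : realType} (p q s : R) : R := Num.max p (Num.min q s).

Section clamp_theory.
Context {R : realType} (p q : R).
Hypothesis pq : p <= q.

Lemma clamp_itv s : p <= clamp p q s <= q.
Proof. by rewrite /clamp le_max lexx ge_max pq ge_min lexx. Qed.

Lemma clamp_id s : p <= s <= q -> clamp p q s = s.
Proof. by move=> /andP[ps sq]; rewrite /clamp min_r// max_r. Qed.

Lemma clamp_continuous : continuous (clamp p q).
Proof.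
move=> s; refine (cont_max _ _ s _ _); first exact: cont_cst.
by apply: cont_min; [exact: cont_cst|exact: cont_id].
Qed.

End clamp_theory.

Section slices.
Context {R : realType} {n : nat} (Omega : set 'rV[R]_n) (T : R) (f : 'rV[R]_n * R -> R).
Hypothesis oO : open Omega.

Lemma within_slice x t : {within cylinder Omega T, continuous f} ->
  Omega x -> 0 < t <= T -> {for x, continuous (fun z => f (z, t))}.
Proof.
move=> cf Ox tT; apply: (cont_within_comp (cylinder Omega T) f (fun z => (z, t))) => //.
  by apply: cont_pair; [exact: cont_id|exact: cst_continuous].
by have := open_nbhs_nbhs (conj oO Ox); apply: filterS => z Oz; split.
Qed.

Let nbhs_clamp (x : 'rV[R]_n) (s : R) : Omega x -> nbhs (x, s) [set z | Omega z.1].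
Proof.
move=> Ox; have h : nbhs x Omega by exact: open_nbhs_nbhs.
exact: (@cvg_fst _ _ (nbhs x) (nbhs s) _ Omega h).
Qed.

Let cont_clamp_pair (p q : R) x s :
  {for (x, s), continuous (fun z : 'rV[R]_n * R => (z.1, clamp p q z.2))}.
Proof.
apply: cont_pair; first exact: cvg_fst.
by apply: (@continuous_comp _ _ _ snd (clamp p q)); [exact: cvg_snd|exact: clamp_continuous].
Qed.

Lemma within_clamp (p q : R) x s : {within cylinder Omega T, continuous f} ->
  0 < p -> p <= q -> q <= T -> Omega x ->
  {for (x, s), continuous (fun z : 'rV[R]_n * R => f (z.1, clamp p q z.2))}.
Proof.
move=> cf p0 pq qT Ox.
apply: (cont_within_comp _ f (fun z => (z.1, clamp p q z.2)) _ cf); first exact: cont_clamp_pair.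
have := nbhs_clamp x s Ox; apply: filterS => -[z r] /= Oz; split => //=.
by have := clamp_itv p q pq r; lra.
Qed.

Lemma within_clamp0 (p q : R) x s : {within closed_cylinder Omega T, continuous f} ->
  0 <= p -> p <= q -> q <= T -> Omega x ->
  {for (x, s), continuous (fun z : 'rV[R]_n * R => f (z.1, clamp p q z.2))}.
Proof.
move=> cf p0 pq qT Ox.
apply: (cont_within_comp _ f (fun z => (z.1, clamp p q z.2)) _ cf); first exact: cont_clamp_pair.
have := nbhs_clamp x s Ox; apply: filterS => -[z r] /= Oz; split => //=.
by have := clamp_itv p q pq r; lra.
Qed.

(** At a time t < T the increments that are allowed in [dt_filter] are all the small ones. *)
Lemma t_derive x t : 0 < t < T -> t_derivable T f (x, t) ->
  is_derive t 1 (fun s => f (x, s)) (dt T f (x, t)).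
Proof.
move=> tT; have FE : dt_filter T t = (0 : R)^'.
  have h : \forall h \near (0 : R)^', 0 < t + h <= T.
    have h1 : \forall h \near (0 : R), 0 < t + h <= T.
      apply/nbhs_ballP; exists (Num.min t (T - t)) => /=.
        by rewrite lt_min; apply/andP; split; lra.
      move=> h; rewrite -ball_normE /= sub0r normrN lt_min => /andP[].
      by rewrite !ltr_norml; lra.
    by apply: filterS (nbhs_dnbhs h1).
  apply/seteqP; split => P; rewrite /dt_filter /within /= => hP.
    by apply: filterS2 h hP => z h1 h2; exact: h2.
  by apply: filterS hP.
have QE : t_quotient f (x, t) =
    (fun h => h^-1 *: ((fun s => f (x, s)) (h *: 1 + t) - (fun s => f (x, s)) t)).
  by apply/funext => h; rewrite /t_quotient /GRing.scale /= mulr1 [t + h]addrC.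
rewrite /t_derivable /dt FE QE => h; split; first exact: h.
by [].
Qed.

End slices.

Lemma sqdist_gt0 {R : realType} {n : nat} (x y : 'rV[R]_n) : x != y -> 0 < sqdist x y.
Proof.
move=> xy; rewrite -enorm_sqd exprn_gt0//.
by apply: lt_le_trans (norm_le_enorm _); rewrite normr_gt0 subr_eq0.
Qed.

Lemma open_boundary {R : realType} {n : nat} (Omega : set 'rV[R]_n) x y :
  open Omega -> Omega x -> boundary Omega y -> 0 < sqdist x y.
Proof.
move=> oO Ox [_ nOy]; apply: sqdist_gt0; apply/eqP => xy.
by apply: nOy; rewrite -xy (interior_id _).1.
Qed.

Section test_function.
Context {R : realType} {n : nat} {J : finType}.
Variables (Omega : set 'rV[R]_n) (y : J -> 'rV[R]_n) (m al S K : R) (j0 : J).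
Hypotheses (x0 : forall x j, Omega x -> 0 < sqdist x (y j)) (K0 : 0 < K).

Let W := barrier y m al S.

(** Extension by 0: the formulas for the barrier are meaningless outside of [Omega], where they
    may even involve powers of 0. *)
Definition ext0 (x : 'rV[R]_n) (r : R) : R := if asbool (Omega x) then r else 0.
Definition test_fun x t := ext0 x (profile K (W x t)).
Definition test_fun_x i x t := ext0 x (profile' K (W x t) * barrier_x y m al S i x t).
Definition test_fun_xx i x t := ext0 x
  (profile'' K (W x t) * barrier_x y m al S i x t ^+ 2 + profile' K (W x t) * barrier_xx y m al S i x t).
Definition test_fun_t x t := ext0 x (profile' K (W x t) * barrier_t y m al S x t).

Lemma ext0T x r : Omega x -> ext0 x r = r.
Proof. by move=> Ox; rewrite /ext0; case: asboolP. Qed.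

Lemma ext0F x r : ~ Omega x -> ext0 x r = 0.
Proof. by move=> Ox; rewrite /ext0; case: asboolP. Qed.

Let W0 x t : 0 < W x t.
Proof. exact: barrier_gt0. Qed.

Lemma test_fun_ge0 x t : 0 <= test_fun x t.
Proof. by rewrite /test_fun /ext0; case: ifP => // _; exact: profile_ge0. Qed.

Lemma test_fun_eq0 x t : (Omega x -> K <= W x t) -> [/\ test_fun x t = 0,
  forall i, test_fun_x i x t = 0, forall i, test_fun_xx i x t = 0 & test_fun_t x t = 0].
Proof.
move=> h; have [Ox|nOx] := pselect (Omega x); last first.
  by split=> *; rewrite /test_fun /test_fun_x /test_fun_xx /test_fun_t ext0F.
have [e1 e2 e3] := profile_eq0 _ _ (h Ox).
by split=> *; rewrite /test_fun /test_fun_x /test_fun_xx /test_fun_t ext0T// ?e1 ?e2 ?e3 ?mul0r ?addr0.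
Qed.

Let near_ext0 (f : 'rV[R]_n -> R) x : open Omega -> Omega x ->
  \near x, f x = ext0 x (f x).
Proof.
move=> oO Ox; have := open_nbhs_nbhs (conj oO Ox); apply: filterS => z Oz.
by rewrite ext0T.
Qed.

Lemma test_fun_derive i x t : open Omega -> Omega x ->
  is_derive x (basis_vec R i) (test_fun ^~ t) (test_fun_x i x t).
Proof.
move=> oO Ox; rewrite /test_fun_x ext0T//.
apply: near_eq_is_derive (near_ext0 (fun x => profile K (W x t)) _ oO Ox) _.
apply: (dir_comp (profile K) (W ^~ t) x); first exact: profile_derive.
by apply: barrier_derive => j; exact: x0.
Qed.

Lemma test_fun_x_derive i x t : open Omega -> Omega x ->
  is_derive x (basis_vec R i) (test_fun_x i ^~ t) (test_fun_xx i x t).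
Proof.
move=> oO Ox; rewrite /test_fun_xx ext0T//.
apply: near_eq_is_derive (near_ext0 (fun x => profile' K (W x t) * barrier_x y m al S i x t) _ oO Ox) _.
have xj j : 0 < sqdist x (y j) by exact: x0.
have d1 := dir_comp (profile' K) (W ^~ t) x _ _ _ (profile'_derive K K0 _ (W0 x t)) (barrier_derive y m al S i x t xj).
have := dirM _ _ _ _ _ _ d1 (barrier_x_derive y m al S i x t xj).
by congr is_derive; ring.
Qed.

Lemma test_fun_t_derive x t : Omega x -> t < S -> is_derive t 1 (test_fun x) (test_fun_t x t).
Proof.
move=> Ox tS; rewrite (_ : test_fun x = fun t => profile K (W x t)); last first.
  by apply/funext => s; rewrite /test_fun ext0T.
rewrite /test_fun_t ext0T//; apply: (dir_comp (profile K) (W x) t); first exact: profile_derive.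
exact: barrier_t_derive.
Qed.

Section continuity.
Variables (x : 'rV[R]_n) (t : R).
Hypotheses (oO : open Omega) (Ox : Omega x) (tS : t < S).

Let xj j : 0 < sqdist x (y j). Proof. exact: x0. Qed.

Let ext0_cont (f : 'rV[R]_n -> R -> R) :
  {for (x, t), continuous (fun p : 'rV[R]_n * R => f p.1 p.2)} ->
  {for (x, t), continuous (fun p : 'rV[R]_n * R => ext0 p.1 (f p.1 p.2))}.
Proof.
move=> cf; have h : nbhs x Omega by exact: open_nbhs_nbhs.
have : (fun p : 'rV[R]_n * R => ext0 p.1 (f p.1 p.2)) @ (x, t) --> f x t.
  apply: cvg_trans cf; apply: near_eq_cvg.
  have hn : nbhs (x, t) [set z : 'rV[R]_n * R | Omega z.1].
    exact: (@cvg_fst _ _ (nbhs x) (nbhs t) _ Omega h).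
  by apply: filterS hn => -[z s] /= Oz; rewrite ext0T.
by rewrite -{1}(ext0T x (f x t) Ox).
Qed.

Let cW : {for (x, t), continuous (fun p : 'rV[R]_n * R => W p.1 p.2)}.
Proof. exact: barrier_continuous. Qed.

Let cp1 : {for (x, t), continuous (fun p : 'rV[R]_n * R => profile' K (W p.1 p.2))}.
Proof.
apply: (cont_comp (profile' K) (fun p : 'rV[R]_n * R => W p.1 p.2)) => //.
apply/differentiable_continuous/derivable1_diffP.
by have [] := profile'_derive K K0 _ (W0 x t).
Qed.

Lemma test_fun_continuous : {for (x, t), continuous (fun p : 'rV[R]_n * R => test_fun p.1 p.2)}.
Proof.
apply: (ext0_cont (fun x t => profile K (W x t))).
apply: (cont_comp (profile K) (fun p : 'rV[R]_n * R => W p.1 p.2)) => //.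
apply/differentiable_continuous/derivable1_diffP.
by have [] := profile_derive K K0 _ (W0 x t).
Qed.

Lemma test_fun_x_continuous i :
  {for (x, t), continuous (fun p : 'rV[R]_n * R => test_fun_x i p.1 p.2)}.
Proof.
apply: (ext0_cont (fun x t => profile' K (W x t) * barrier_x y m al S i x t)).
by apply: contM => //; exact: barrier_x_continuous.
Qed.

Lemma test_fun_xx_continuous i :
  {for (x, t), continuous (fun p : 'rV[R]_n * R => test_fun_xx i p.1 p.2)}.
Proof.
apply: (ext0_cont (fun x t => profile'' K (W x t) * barrier_x y m al S i x t ^+ 2 +
  profile' K (W x t) * barrier_xx y m al S i x t)).
apply: contD; apply: contM => //.
- apply: (cont_comp (profile'' K) (fun p : 'rV[R]_n * R => W p.1 p.2)) => //.
  exact: profile''_continuous.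
- by apply: contX; exact: barrier_x_continuous.
- exact: barrier_xx_continuous.
Qed.

Lemma test_fun_t_continuous :
  {for (x, t), continuous (fun p : 'rV[R]_n * R => test_fun_t p.1 p.2)}.
Proof.
apply: (ext0_cont (fun x t => profile' K (W x t) * barrier_t y m al S x t)).
by apply: contM => //; exact: barrier_t_continuous.
Qed.

End continuity.

(** The chain rule and the inequality for the barrier leave a |grad W|^2 times the quantity
    bounded in [profile_key]. *)
Lemma test_fun_supersol x t (A G : R) (dA : 'I_n -> R) : Omega x -> 0 <= G ->
  2 * (A * \sum_i barrier_x y m al S i x t ^+ 2) / W x t <=
    barrier_t y m al S x t + \sum_i (dA i * barrier_x y m al S i x t + A * barrier_xx y m al S i x t) ->
  0 <= A * \sum_i barrier_x y m al S i x t ^+ 2 <= G * W x t ^+ 2 ->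
  test_fun_t x t + \sum_i (dA i * test_fun_x i x t + A * test_fun_xx i x t) <= 6 / K * G.
Proof.
move=> Ox G0; set g := A * \sum_i _; set B := barrier_t _ _ _ _ _ _ + _ => h1 /andP[g0 h2].
have -> : test_fun_t x t + \sum_i (dA i * test_fun_x i x t + A * test_fun_xx i x t) =
    profile' K (W x t) * B + profile'' K (W x t) * g.
  rewrite /test_fun_t ext0T// /B mulrDr -addrA; congr (_ + _).
  rewrite /g !mulr_sumr -big_split; apply: eq_bigr => i _ /=.
  by rewrite /test_fun_x /test_fun_xx !ext0T//; ring.
have w0 := W0 x t; have p0 := profile'_le0 K K0 _ w0.
have k := profile_key K K0 _ w0.
apply: (@le_trans _ _ ((2 * profile' K (W x t) / W x t + profile'' K (W x t)) * g)).
  rewrite [leRHS](_ : _ = profile' K (W x t) * (2 * g / W x t) + profile'' K (W x t) * g); last by ring.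
  by rewrite lerD2r ler_wnM2l.
apply: le_trans (ler_wpM2r g0 k) _.
rewrite [leLHS](_ : _ = 6 / K * (g / W x t ^+ 2)); last by ring.
by rewrite ler_wpM2l ?divr_ge0 ?(ltW K0)// ler_pdivrMr ?exprn_gt0.
Qed.

End test_function.

(** * Energy inequality on a time step *)

Section fixed_time.
Context {R : realType} {n : nat} {Omega : set 'rV[R]_n} {T : R} {a u : 'rV[R]_n * R -> R}.
Hypotheses (oO : open Omega) (a_C10 : C10 Omega T a) (u_C21 : C21 Omega T u).
Hypothesis u_eq : forall p, cylinder Omega T p ->
  dt T u p = divergence (fun q => a q *: grad u q) p.

Lemma dx_is_derive (f : 'rV[R]_n * R -> R) i x t : x_derivable f i (x, t) ->
  is_derive x (basis_vec R i) (fun z => f (z, t)) (dx i f (x, t)).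
Proof. by move=> h; apply: DeriveDef. Qed.

(** The divergence form is expanded by the product rule. *)
Lemma expanded_equation x t : Omega x -> 0 < t <= T ->
  dt T u (x, t) = \sum_i (dx i a (x, t) * dx i u (x, t) + a (x, t) * dx i (dx i u) (x, t)).
Proof.
move=> Ox tT; have cyl : cylinder Omega T (x, t) by split.
rewrite u_eq//; apply: eq_bigr => i _.
have [[_ Du] Ddu _ _] := u_C21.
have d1 := dx_is_derive a i x t ((a_C10.2 i).1 _ cyl).
have d2 := dx_is_derive (dx i u) i x t (((Ddu i).2 i).1 _ cyl).
have [_ <-] := dirM _ _ _ _ _ _ d1 d2.
rewrite {1}/dx /=; congr ('D_ _ _ _); apply/funext => z.
by rewrite !mxE.
Qed.

End fixed_time.

Section step.
Context {R : realType} {n : nat} {J : finType}.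
Variables (Omega : set 'rV[R]_n) (T : R) (a u : 'rV[R]_n * R -> R).
Variables (y : J -> 'rV[R]_n) (m al S K t0 tau eps M L : R) (j0 : J).
Hypotheses (oO : open Omega) (OL : forall x, Omega x -> `|x| <= L).
Hypotheses (a_C10 : C10 Omega T a) (a_ge0 : forall p, cylinder Omega T p -> 0 <= a p).
Hypotheses (u_C21 : C21 Omega T u) (u_cont : {within closed_cylinder Omega T, continuous u}).
Hypothesis u_eq : forall p, cylinder Omega T p ->
  dt T u p = divergence (fun q => a q *: grad u q) p.
Hypotheses (t00 : 0 <= t0) (t0tau : t0 < tau) (tauT : tau <= T) (tauS : tau < S).
Hypotheses (eps0 : 0 < eps) (K0 : 0 < K) (M0 : 0 <= M) (By : forall j, boundary Omega (y j)).
Hypothesis Kbar : forall x t, Omega x -> t0 <= t <= tau -> bdist Omega x < 2 * eps ->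
  K <= barrier y m al S x t.
Hypothesis key : forall x t, Omega x -> t0 < t < tau -> 2 * eps <= bdist Omega x ->
  test_fun_t Omega y m al S K x t + \sum_i (dx i a (x, t) * test_fun_x Omega y m al S K i x t +
    a (x, t) * test_fun_xx Omega y m al S K i x t) <= M.

Local Ltac section_lra :=
  have ? := t00; have ? := t0tau; have ? := tauT; have ? := tauS; have ? := eps0; lra.

Let phi := test_fun Omega y m al S K.
Let C := inner_closed Omega (2 * eps).
Let C2 := inner_closed Omega eps.

Let y0 x j : Omega x -> 0 < sqdist x (y j).
Proof. by move=> Ox; exact: open_boundary (By j). Qed.

(** A continuous function between the indicator functions of the sets where the distance to the
    boundary is at least [2 * eps] and more than [eps]. *)
Definition ramp x : R := ext0 Omega x (Num.min 1 (Num.max 0 (bdist Omega x / eps - 1))).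

Lemma ramp_itv x : 0 <= ramp x <= 1.
Proof.
rewrite /ramp /ext0; case: ifP => _; last by rewrite lexx ler01.
by rewrite le_min ler01 le_max lexx /= ge_min lexx.
Qed.

Lemma ramp1 x : Omega x -> 2 * eps <= bdist Omega x -> ramp x = 1.
Proof.
move=> Ox ex; rewrite /ramp ext0T// max_r ?min_l//.
  by rewrite lerBrDr ler_pdivlMr//; section_lra.
by rewrite subr_ge0 ler_pdivlMr//; section_lra.
Qed.

Lemma ramp_inner x : ~ inner_set Omega eps x -> ramp x = 0.
Proof.
move=> nC; have [Ox|nOx] := pselect (Omega x); last by rewrite /ramp ext0F.
rewrite /ramp ext0T// max_l ?min_r// subr_le0 ler_pdivrMr// mul1r leNgt.
by apply/negP => h; apply: nC.
Qed.

Lemma ramp0 x : ~ C2 x -> ramp x = 0.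
Proof. by move=> nC; apply: ramp_inner => -[Ox ex]; apply: nC; split => //; exact: ltW. Qed.

Let cC : closed C. Proof. by apply: inner_closed_closed => //; rewrite mulr_gt0. Qed.
Let cC2 : closed C2. Proof. exact: inner_closed_closed. Qed.
Let CO : C `<=` Omega. Proof. by move=> x []. Qed.
Let C2O : C2 `<=` Omega. Proof. by move=> x []. Qed.

Let cramp x : Omega x -> {for x, continuous ramp}.
Proof.
move=> Ox; pose r x : R := Num.min 1 (Num.max 0 (bdist Omega x / eps - 1)).
have cr : {for x, continuous r}.
  apply: cont_min; first exact: cont_cst.
  apply: cont_max; first exact: cont_cst.
  apply: contB; last exact: cont_cst.
  by apply: contM; [exact: bdist_continuous|exact: cont_cst].
have : ramp @ x --> r x; last by rewrite -{1}(ext0T Omega x (r x) Ox).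
apply: cvg_trans cr; apply: near_eq_cvg; first exact: nbhs_filter.
have hO : nbhs x Omega by exact: open_nbhs_nbhs.
by apply: filterS hO => z Oz; rewrite /ramp ext0T.
Qed.

Let t_itv t : t0 < t < tau -> 0 < t <= T /\ t < S.
Proof. by move=> ?; split; section_lra. Qed.

Let test_fun_off x t : ~ C x -> t0 <= t <= tau -> [/\ phi x t = 0,
  forall i, test_fun_x Omega y m al S K i x t = 0,
  forall i, test_fun_xx Omega y m al S K i x t = 0 & test_fun_t Omega y m al S K x t = 0].
Proof.
move=> nC tt; apply: test_fun_eq0 => Ox; apply: Kbar => //.
by rewrite ltNge; apply/negP => h; apply: nC; split.
Qed.

Let f (z : 'rV[R]_n * R) := smooth_abs (u z) * phi z.1 z.2.
Let g (z : 'rV[R]_n * R) := phi z.1 z.2 * smooth_abs' (u z) * dt T u z +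
  smooth_abs (u z) * test_fun_t Omega y m al S K z.1 z.2.
Let h (z : 'rV[R]_n * R) := smooth_abs (u z) * ramp z.1.
Let cl (p q : R) (z : 'rV[R]_n * R) : 'rV[R]_n * R := (z.1, clamp p q z.2).

Let slice_at (F : 'rV[R]_n -> R -> R) x t :
  {for (x, t), continuous (fun p : 'rV[R]_n * R => F p.1 p.2)} ->
  {for x, continuous (F ^~ t)}.
Proof.
move=> cF; apply: (@continuous_comp _ _ _ (fun z => (z, t)) (fun p : 'rV[R]_n * R => F p.1 p.2)) => //.
by apply: cont_pair; [exact: cont_id|exact: cst_continuous].
Qed.

Let clamp_at (F : 'rV[R]_n -> R -> R) p q x s :
  {for (x, clamp p q s), continuous (fun p : 'rV[R]_n * R => F p.1 p.2)} ->
  {for (x, s), continuous (fun z : 'rV[R]_n * R => F z.1 (clamp p q z.2))}.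
Proof.
move=> cF.
apply: (@continuous_comp _ _ _ (cl p q) (fun p : 'rV[R]_n * R => F p.1 p.2)) => //.
apply: cont_pair; first exact: cvg_fst.
by apply: (@continuous_comp _ _ _ snd (clamp p q)); [exact: cvg_snd|exact: clamp_continuous].
Qed.

Let cslab (F : 'rV[R]_n * R -> R) (B : set 'rV[R]_n) : closed B -> B `<=` Omega ->
  (forall x s, Omega x -> {for (x, s), continuous F}) -> (forall x s, ~ B x -> F (x, s) = 0) ->
  continuous F.
Proof.
move=> cB BO cF F0; apply: (cont_supp (fst @^-1` Omega) (fst @^-1` B) F F) => //.
- by apply: open_comp => // z _; exact: cvg_fst.
- by apply: closed_comp => // z _; exact: cvg_fst.
- by move=> [z s]; exact: BO.
- by move=> [z s]; exact: F0.
- by move=> [z s]; exact: cF.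
Qed.

Let cu0 x s : Omega x -> {for (x, s), continuous (fun z => u (cl t0 tau z))}.
Proof. by move=> Ox; apply: (within_clamp0 Omega T) => //; exact: ltW. Qed.

Let cf : continuous (fun z => f (cl t0 tau z)).
Proof.
apply: (cslab _ C) => //.
  move=> x s Ox; apply: contM.
    by apply: (cont_comp smooth_abs (fun z => u (cl t0 tau z))); [exact: smooth_abs_continuous|exact: cu0].
  apply: (clamp_at phi); apply: test_fun_continuous => //.
  by have := clamp_itv t0 tau (ltW t0tau) s; section_lra.
move=> x s nC; have [e _ _ _] := test_fun_off x (clamp t0 tau s) nC (clamp_itv _ _ (ltW t0tau) _).
by rewrite /f /= e mulr0.
Qed.

Let ch : continuous (fun z => h (cl t0 tau z)).
Proof.
apply: (cslab _ C2) => //.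
  move=> x s Ox; apply: contM.
    by apply: (cont_comp smooth_abs (fun z => u (cl t0 tau z))); [exact: smooth_abs_continuous|exact: cu0].
  by apply: (@continuous_comp _ _ _ fst ramp); [exact: cvg_fst|exact: cramp].
by move=> x s nC; rewrite /h /= ramp0 ?mulr0.
Qed.

Let cg p q : t0 < p -> p <= q -> q < tau -> continuous (fun z => g (cl p q z)).
Proof.
move=> tp pq qt; have [_ _ Dtu cdtu] := u_C21; have [[cu _] _ _ _] := u_C21.
have c1 (F : 'rV[R]_n * R -> R) x s : {within cylinder Omega T, continuous F} -> Omega x ->
    {for (x, s), continuous (fun z => F (cl p q z))}.
  by move=> cF Ox; apply: (within_clamp Omega T) => //; section_lra.
apply: (cslab _ C) => //.
  move=> x s Ox; have cS : clamp p q s < S by have := clamp_itv p q pq s; section_lra.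
  apply: contD; apply: contM.
  - apply: contM; first by apply: (clamp_at phi); exact: test_fun_continuous.
    by apply: (cont_comp smooth_abs' (fun z => u (cl p q z))); [exact: smooth_abs'_continuous|exact: c1].
  - exact: c1.
  - by apply: (cont_comp smooth_abs (fun z => u (cl p q z))); [exact: smooth_abs_continuous|exact: c1].
  - by apply: (clamp_at (test_fun_t Omega y m al S K)); exact: test_fun_t_continuous.
move=> x s nC; have := clamp_itv p q pq s => cpq.
have [|e1 _ _ e2] := test_fun_off x (clamp p q s) nC; first by section_lra.
by rewrite /g /= e1 e2 !mul0r mulr0 addr0.
Qed.

Let E s := integral_Rn (fun x => f (x, clamp t0 tau s)).
Let H s := integral_Rn (fun x => h (x, clamp t0 tau s)).

Let CL x : C x -> `|x| <= L. Proof. by move=> [/OL]. Qed.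
Let C2L x : C2 x -> `|x| <= L. Proof. by move=> [/OL]. Qed.

Let sf t : t0 <= t <= tau -> supp_in L (fun x => f (x, t)).
Proof.
move=> tt; apply: (supp_in_closed C L _ CL) => x nC.
by have [e _ _ _] := test_fun_off x t nC tt; rewrite /f /= e mulr0.
Qed.

Let sh t : supp_in L (fun x => h (x, t)).
Proof. by apply: (supp_in_closed C2 L _ C2L) => x nC; rewrite /h /= ramp0 ?mulr0. Qed.

Let cE : continuous E.
Proof.
apply: (integral_Rn_continuous L (fun z => f (cl t0 tau z)) cf) => s.
exact: sf (clamp_itv _ _ (ltW t0tau) _).
Qed.

Let cH : continuous H.
Proof. by apply: (integral_Rn_continuous L (fun z => h (cl t0 tau z)) ch) => s; exact: (sh (clamp t0 tau s)). Qed.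

Let dE t : t0 < t < tau -> is_derive t 1 E (integral_Rn (fun x => g (x, t))).
Proof.
move=> tt; pose p := (t0 + t) / 2; pose q := (t + tau) / 2.
have ptq : p < t < q by rewrite /p /q; section_lra.
have tp : t0 < p by rewrite /p; section_lra.
have qt : q < tau by rewrite /q; section_lra.
have [B [B0 hB]] := bounded_on_slab _ L p q (cg p q tp ltac:(section_lra) qt).
pose fx (z : 'rV[R]_n * R) := f (cl t0 tau z).
apply: (@integral_Rn_is_derive R n L B fx g p q t) => //.
- by move=> s spq; exact: continuous_slice cf.
- by move=> s; exact: sf (clamp_itv _ _ (ltW t0tau) _).
- move=> x s spq.
  apply: (@near_eq_is_derive _ _ _ (fun s => f (x, s))).
    have hs : t0 < s < tau by section_lra.
    have : s \in `]t0, tau[ by rewrite in_itv.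
    move=> /near_in_itvoo; apply: filterS => r; rewrite in_itv /= => hr.
    by rewrite /fx /cl /= clamp_id//; section_lra.
  have [Ox|nOx] := pselect (Omega x); last first.
    have nC : ~ C x by move=> /CO.
    rewrite (_ : (fun s => _) = fun=> 0); last first.
      by apply/funext => r; rewrite /f /phi /test_fun ext0F// mulr0.
    have [|e1 _ _ e2] := test_fun_off x s nC; first by section_lra.
    by rewrite /g /= e1 e2 !mul0r mulr0 addr0; exact: dir_cst.
  have [_ _ Dtu _] := u_C21.
  have du : is_derive s 1 (fun s => u (x, s)) (dt T u (x, s)).
    apply: t_derive; first by section_lra.
    by apply: Dtu; split => //=; section_lra.
  have dp : is_derive s 1 (phi x) (test_fun_t Omega y m al S K x s).
    by apply: test_fun_t_derive => //; section_lra.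
  have := dirM _ _ _ _ _ _ (dir_comp smooth_abs (fun s => u (x, s)) s _ _ _ (smooth_abs_derive _) du) dp.
  by congr is_derive; rewrite /g /=; ring.
- move=> x s spq; have [xL|Lx] := leP `|x| L.
    by have := hB x s xL; rewrite /cl /= clamp_id; [apply|]; section_lra.
  have nC : ~ C x by move=> /CL; rewrite leNgt Lx.
  have [|e1 _ _ e2] := test_fun_off x s nC; first by section_lra.
  by rewrite /g /= e1 e2 !mul0r mulr0 addr0 normr0.
Qed.

Let dE_le t : t0 < t < tau -> integral_Rn (fun x => g (x, t)) <= M * integral_Rn (fun x => h (x, t)).
Proof.
move=> tt; have [tT tS] := t_itv t tt; have tc : t0 <= t <= tau by section_lra.
have [ca Da] := a_C10; have [[cu Du] Ddu Dtu cdtu] := u_C21.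
have cyl x : Omega x -> cylinder Omega T (x, t) by move=> Ox; split.
have sl (F : 'rV[R]_n * R -> R) (x : 'rV[R]_n) : {within cylinder Omega T, continuous F} -> Omega x ->
  {for x, continuous (fun z : 'rV[R]_n => F (z, t))}.
  by move=> cF Ox; exact: (within_slice Omega T F oO x t cF Ox tT).
apply: (@energy_ineq R n Omega C C2 L M oO cC CO cC2 C2O CL C2L (fun x => u (x, t))
  (fun x => a (x, t)) (fun x => dt T u (x, t)) (phi ^~ t) (test_fun_t Omega y m al S K ^~ t) ramp
  (fun i x => dx i u (x, t)) (fun i x => dx i a (x, t)) (fun i x => dx i (dx i u) (x, t))
  (fun i x => test_fun_x Omega y m al S K i x t) (fun i x => test_fun_xx Omega y m al S K i x t)).
- by move=> x; exact: sl.
- by move=> x; exact: sl.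
- by move=> x; exact: sl.
- by move=> i x; apply: sl; exact: (Du i).2.
- by move=> i x; apply: sl; exact: (Da i).2.
- by move=> i x; apply: sl; exact: ((Ddu i).2 i).2.
- by move=> x Ox; apply: slice_at; exact: test_fun_continuous.
- by move=> x Ox; apply: slice_at; exact: test_fun_t_continuous.
- by move=> i x Ox; apply: (slice_at (test_fun_x Omega y m al S K i)); exact: test_fun_x_continuous.
- by move=> i x Ox; apply: (slice_at (test_fun_xx Omega y m al S K i)); exact: test_fun_xx_continuous.
- exact: cramp.
- by move=> i x Ox; apply: dx_is_derive; apply: (Du i).1; exact: cyl.
- by move=> i x Ox; apply: dx_is_derive; apply: (Da i).1; exact: cyl.
- by move=> i x Ox; apply: dx_is_derive; apply: ((Ddu i).2 i).1; exact: cyl.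
- by move=> i x Ox; exact: test_fun_derive.
- by move=> i x Ox; exact: test_fun_x_derive.
- by move=> x nC; have [] := test_fun_off x t nC tc.
- by move=> x nC; have [] := test_fun_off x t nC tc.
- by move=> i x nC; have [_ + _ _] := test_fun_off x t nC tc; apply.
- by move=> i x nC; have [_ _ + _] := test_fun_off x t nC tc; apply.
- exact: ramp0.
- by move=> x; exact: test_fun_ge0.
- by move=> x Ox; apply: a_ge0; exact: cyl.
- by move=> x Ox; exact: expanded_equation.
- move=> x Ox; have [ex|xe] := leP (2 * eps) (bdist Omega x).
    by rewrite ramp1// mulr1; exact: key.
  have [e1 e2 e3 ->] := test_fun_eq0 Omega y m al S K x t (fun _ => Kbar x t Ox tc xe).
  rewrite big1 => [|i _]; last by rewrite e2 e3 !mulr0 addr0.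
  by rewrite addr0 mulr_ge0//; have /andP[] := ramp_itv x.
Qed.

(** The integral of beta(u) phi has a time derivative, given by differentiation under the
    integral, to which [energy_ineq] applies. The error [M] only occurs where the test
    function does not vanish, a set on which [ramp] is 1. *)
Lemma step_energy :
  integral_Rn (fun x => smooth_abs (u (x, tau)) * test_fun Omega y m al S K x tau) <=
  integral_Rn (fun x => smooth_abs (u (x, t0)) * test_fun Omega y m al S K x t0) +
  M * \int[@lebesgue_measure R]_(t in `[t0, tau]) integral_Rn (fun x => smooth_abs (u (x, t)) * ramp x).
Proof.
have := le_increment_integral E H M t0 tau t0tau cE cH _.
rewrite /E !clamp_id ?lexx ?(ltW t0tau)// lerBlDl => /(_ _)/le_trans; apply.
  move=> t tt; exists (integral_Rn (fun x => g (x, t))); first exact: dE.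
  by rewrite /H clamp_id; [exact: dE_le|section_lra].
rewrite lerD2l ler_wpM2l// le_eqVlt; apply/orP; left; apply/eqP.
apply: eq_Rintegral => t; rewrite inE /= in_itv /= => tt.
by rewrite /H clamp_id.
Qed.

Lemma step_cont : continuous (fun x => smooth_abs (u (x, tau)) * test_fun Omega y m al S K x tau) /\
  supp_in L (fun x => smooth_abs (u (x, tau)) * test_fun Omega y m al S K x tau).
Proof.
split; last by apply: sf; rewrite lexx ltW.
have := continuous_slice _ tau cf; congr (continuous _).
by apply/funext => x; rewrite /cl /= clamp_id// lexx ltW.
Qed.

Lemma ramp_cont t : t0 <= t <= tau -> continuous (fun x => smooth_abs (u (x, t)) * ramp x) /\
  supp_in L (fun x => smooth_abs (u (x, t)) * ramp x).
Proof.
move=> tt; split; last exact: sh.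
have := continuous_slice _ t ch; congr (continuous _).
by apply/funext => x; rewrite /cl /= clamp_id.
Qed.

End step.

(** * Growth of the exponential and finite nets of the boundary *)

(** The exponential is the power of exponent p + 1 of expR (X / (p + 1)), which is larger than
    X / (p + 1). *)
Lemma expR_gt_pow {R : realType} (A : R) (p : nat) : 0 <= A ->
  exists2 X0, 1 <= X0 & forall X, X0 <= X -> A * X ^+ p < expR X.
Proof.
move=> A0; pose q : R := p.+1%:R; have q0 : 0 < q by [].
exists (A * q ^+ p.+1 + 1); first by rewrite lerDr mulr_ge0// exprn_ge0// ltW.
move=> X XX; have X1 : 1 <= X by apply: le_trans XX; rewrite lerDr mulr_ge0// exprn_ge0// ltW.
have X0 : 0 < X by apply: lt_le_trans X1.
have h : (X / q) ^+ p.+1 <= expR X.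
  have -> : expR X = expR (X / q) ^+ p.+1.
    by rewrite -expRM_natl mulrC -mulrA mulVf ?mulr1// gt_eqF.
  have d0 : 0 <= X / q by rewrite divr_ge0// ltW.
  rewrite ler_pXn2r ?nnegrE ?expR_ge0//.
  by apply: le_trans (expR_ge1Dx _); rewrite lerDr.
apply: lt_le_trans h; rewrite expr_div_n ltr_pdivlMr ?exprn_gt0//.
by rewrite mulrAC [X ^+ _.+1]exprS ltr_pM2r ?exprn_gt0//; lra.
Qed.

Lemma boundary_bound {R : realType} {n : nat} (Omega : set 'rV[R]_n) (L : R) :
  (forall x, Omega x -> `|x| <= L) -> forall y, boundary Omega y -> `|y| <= L.
Proof.
move=> OL y [cy _].
have cl : closed [set x : 'rV[R]_n | `|x| <= L].
  apply: (@closed_comp _ _ (fun x : 'rV[R]_n => `|x|) [set s : R | s <= L]).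
    by move=> x _; exact: norm_continuous.
  exact: closed_le.
by move: cy => /(closure_subset (B := [set x : 'rV[R]_n | `|x| <= L]) OL); rewrite -(closure_id _).1.
Qed.

(** A grid of mesh eps / (n + 1) is laid over the cube of radius L, and one point of [B] is chosen
    in each cell that meets [B]. The other cells receive an arbitrary point of [B], so that the
    net is indexed by all the cells and the number k^n of its elements is explicit. *)
Lemma boundary_net {R : realType} {n : nat} (B : set 'rV[R]_n) (L eps : R) :
  B !=set0 -> (forall z, B z -> `|z| <= L) -> 0 < eps <= 1 ->
  exists (k : nat) (y : {ffun 'I_n -> 'I_k} -> 'rV[R]_n),
    [/\ k%:R <= (2 * L * n.+1%:R + 1) / eps, inhabited {ffun 'I_n -> 'I_k},
        forall j, B (y j) & forall z, B z -> exists j, sqdist z (y j) <= eps ^+ 2].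
Proof.
(* A cell of side h has a diagonal of squared length n h^2 <= eps^2. *)
move=> [y0 By0] BL /andP[e0 e1]; pose h := eps / n.+1%:R.
have h0 : 0 < h by rewrite divr_gt0.
have L0 : 0 <= L by apply: le_trans (normr_ge0 _) (BL _ By0).
pose k := (Num.truncn (2 * L / h)).+1.
pose cell (z : 'rV[R]_n) : {ffun 'I_n -> 'I_k} :=
  [ffun i => inord (Num.truncn ((z ord0 i + L) / h))].
pose y j := xget y0 [set z | B z /\ cell z = j].
have yB j : B (y j).
  by rewrite /y; case: xgetP => [z _ []|].
exists k, y; split => //.
- have : (Num.truncn (2 * L / h))%:R <= 2 * L / h.
    by rewrite truncn_le divr_ge0 ?(ltW h0)// mulr_ge0.
  have -> : k%:R = (Num.truncn (2 * L / h))%:R + 1 :> R by rewrite natr1.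
  move=> hk; apply: le_trans (lerD hk (lexx 1)) _.
  rewrite ler_pdivlMr// mulrDl mul1r /h.
  have -> : 2 * L / (eps / n.+1%:R) * eps = 2 * L * n.+1%:R.
    by rewrite invf_div mulrA divfK// gt_eqF.
  by lra.
- by exists; exact: cell y0.
move=> z Bz; exists (cell z).
have cy : cell (y (cell z)) = cell z.
  by rewrite /y; case: xgetP => [w _ []//|/(_ z)]; case; split.
rewrite /sqdist; apply: (@le_trans _ _ (\sum_(i < n) h ^+ 2)); last first.
  rewrite sumr_const card_ord /h -[leLHS]mulr_natl expr_div_n mulrA ler_pdivrMr ?exprn_gt0//.
  rewrite mulrC ler_wpM2l ?sqr_ge0// -natrX ler_nat.
  by rewrite (leq_trans (leqnSn n))// -mulnn leq_pmulr.
have cb w i : B w -> 0 <= (w ord0 i + L) / h /\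
    (Num.truncn ((w ord0 i + L) / h) < k)%N.
  move=> Bw; have := le_trans (coord_le_norm w i) (BL _ Bw); rewrite ler_norml => /andP[w1 w2].
  have g0 : 0 <= (w ord0 i + L) / h by rewrite divr_ge0 ?(ltW h0)//; lra.
  split=> //; rewrite ltnS le_truncn// ler_wpM2r ?invr_ge0 ?(ltW h0)//; lra.
apply: ler_sum => i _; rewrite -real_normK ?num_real// ler_pXn2r ?nnegrE ?(ltW h0)//.
have [z0 zk] := cb z i Bz; have [v0 vk] := cb _ i (yB (cell z)).
have : Num.truncn ((z ord0 i + L) / h) = Num.truncn ((y (cell z) ord0 i + L) / h).
  move/ffunP: cy => /(_ i); rewrite !ffunE => /(congr1 val) /=.
  by rewrite !inordK.
move: (truncn_itv z0) (truncn_itv v0) => /andP[a1 a2] /andP[b1 b2] e.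
move: a1 a2; rewrite e ler_pdivlMr// ltr_pdivrMr// => a1 a2.
move: b1 b2; rewrite ler_pdivlMr// ltr_pdivrMr// => b1 b2.
move: a1 a2 b1 b2; rewrite -natr1 => a1 a2 b1 b2.
by rewrite ler_norml; apply/andP; split; nra.
Qed.

Lemma bdist_gt0 {R : realType} {n : nat} (Omega : set 'rV[R]_n) x :
  open Omega -> boundary Omega !=set0 -> Omega x -> 0 < bdist Omega x.
Proof.
move=> oO [y0 By0] Ox; have /nbhs_ballP[e /= e0 he] : nbhs x Omega by exact: open_nbhs_nbhs.
apply: (lt_le_trans e0); apply: lb_le_inf; first by exists (enorm (x - y0)), y0.
move=> _ [y [_ nOy] <-]; rewrite leNgt; apply/negP => xy; apply: nOy.
rewrite (interior_id _).1//; apply: he; rewrite -ball_normE /=.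
exact: le_lt_trans (norm_le_enorm _) xy.
Qed.

Lemma sqdist_split {R : realType} {n : nat} (x y z : 'rV[R]_n) :
  sqdist x z <= 2 * sqdist x y + 2 * sqdist y z.
Proof.
rewrite /sqdist !mulr_sumr -big_split; apply: ler_sum => i _ /=.
have := sqr_ge0 ((x ord0 i - y ord0 i) - (y ord0 i - z ord0 i)); nra.
Qed.

Lemma sqdist_bound {R : realType} {n : nat} (L : R) (x y : 'rV[R]_n) : `|x| <= L -> `|y| <= L ->
  sqdist x y <= n.+1%:R * (2 * L) ^+ 2.
Proof.
move=> xL yL; have L0 : 0 <= L := le_trans (normr_ge0 _) xL.
apply: (@le_trans _ _ (\sum_(i < n) (2 * L) ^+ 2)).
  apply: ler_sum => i _; rewrite -real_normK ?num_real// ler_pXn2r ?nnegrE ?mulr_ge0//.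
  apply: le_trans (ler_normB _ _) _.
  by have := coord_le_norm x i; have := coord_le_norm y i; lra.
by rewrite sumr_const card_ord -[leLHS]mulr_natl ler_wpM2r ?sqr_ge0// ler_nat.
Qed.

Lemma le_powR_neg {R : realType} (m x y : R) : m <= 0 -> 0 < x -> x <= y -> y `^ m <= x `^ m.
Proof.
move=> m0 x0 xy; have y0 : 0 < y by apply: lt_le_trans xy.
have [k k0 ->] : exists2 k, 0 <= k & m = - k by exists (- m); rewrite ?oppr_ge0 ?opprK.
rewrite !powRN lef_pV2 ?posrE ?powR_gt0//.
by apply: (ge0_ler_powR k0); rewrite ?nnegrE ?(ltW x0) ?(ltW y0).
Qed.

(** * Decay of the weighted energy *)

Lemma powR_sqr {R : realType} (b e : R) : 0 <= b -> (b ^+ 2) `^ e = b `^ (2 * e).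
Proof. by move=> b0; rewrite powRrM powR_mulrn. Qed.

Lemma integral_Rn0 {R : realType} {n : nat} : integral_Rn (fun _ : 'rV[R]_n => 0 : R) = 0.
Proof. by rewrite /integral_Rn Rintegral_cst// mul0r. Qed.

Lemma ramp_integral_le {R : realType} {n : nat} (Omega : set 'rV[R]_n) (T : R)
    (u : 'rV[R]_n * R -> R) (t0 tau eps L B : R) : 0 < eps -> 0 <= t0 -> tau <= T ->
  (forall t, t0 <= t <= tau -> continuous (fun x => smooth_abs (u (x, t)) * ramp Omega eps x) /\
    supp_in L (fun x => smooth_abs (u (x, t)) * ramp Omega eps x)) ->
  (\int[@lebesgue_measure R]_(t in `[0%R, T])
    integral_rV (inner_set Omega eps) (fun x => `|u (x, t)|%:E) <= B%:E)%E ->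
  \int[@lebesgue_measure R]_(t in `[t0, tau]) integral_Rn (fun x => smooth_abs (u (x, t)) * ramp Omega eps x)
    <= B.
Proof.
move=> eps0 t00 tauT cs hB.
have r01 x : 0 <= ramp Omega eps x <= 1 by exact: ramp_itv.
have s0 t x : 0 <= smooth_abs (u (x, t)) * ramp Omega eps x.
  by rewrite mulr_ge0 ?smooth_abs_ge0//; have /andP[] := r01 x.
have ci0 t : 0 <= integral_Rn (fun x => smooth_abs (u (x, t)) * ramp Omega eps x).
  by apply: Rintegral_ge0 => y _.
have rV0 t : (0 <= integral_rV (inner_set Omega eps) (fun x => `|u (x, t)|%:E))%E.
  by apply: integral_ge0 => y _; rewrite lee_fin.
have le1 : (\int[@lebesgue_measure R]_(t in `[t0, tau])
    (integral_Rn (fun x => smooth_abs (u (x, t)) * ramp Omega eps x))%:E <= B%:E)%E.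
  apply: le_trans hB; apply: ge0_le_integral_nomeas.
  - by move=> t _; rewrite lee_fin.
  - by move=> t _; exact: rV0.
  move=> t; rewrite /patch; case: ifPn; rewrite ?inE ?notin_setE /= in_itv /= => tt.
    rewrite mem_set /=; last by rewrite in_itv /=; lra.
    have [cf sf] := cs t tt.
    rewrite /integral_Rn /Rintegral fineK; last first.
      by apply: integrable_fin_num => //; exact: (integrable_supp_in _ L cf sf).
    apply: ge0_le_integral_nomeas.
    - by move=> y _; rewrite lee_fin.
    - by move=> y _; rewrite lee_fin.
    move=> y; rewrite patch_setT /patch; case: ifPn; rewrite ?inE ?notin_setE /= => yi.
      rewrite lee_fin; apply: le_trans (smooth_abs_le _); rewrite ler_piMr ?smooth_abs_ge0//.
      by have /andP[] := r01 (rV_of_tuple y).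
    by rewrite (ramp_inner _ _ eps0 _ yi) mulr0.
  by case: ifP => // _; exact: rV0.
rewrite /Rintegral -lee_fin fineK//; apply/fin_numPlt/andP; split.
  by apply: (@lt_le_trans _ _ 0%E); [rewrite ltNyr|apply: integral_ge0 => t _; rewrite lee_fin].
by apply: le_lt_trans le1 _; rewrite ltry.
Qed.

Section decay.
Context {R : realType} {n : nat} {J : finType}.
Variables (Omega : set 'rV[R]_n) (T : R) (a u : 'rV[R]_n * R -> R).
Variables (gamma c0 c1 C theta L delta t0 tau eps : R) (y : J -> 'rV[R]_n) (j0 : J).

Let m := 1 - gamma / 2.
Let al := (8 * c0 * m ^+ 2)^-1.
Let X := eps `^ (- gamma + 2).
Let S := t0 + delta.
Let K := expR ((theta + 1) * X).

(** The two lower bounds that involve [delta] express that the time step is short. The first one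
    makes the reciprocal of the barrier a supersolution. The second one makes the barrier at
    least [K] where the distance to the boundary is less than [2 * eps]: such a point is at a
    squared distance at most 10 eps^2 from a point of the net, whence the factor 10^m. *)
Lemma energy_decay :
  open Omega -> (forall x, Omega x -> `|x| <= L) -> 0 < L ->
  C10 Omega T a -> (forall p, cylinder Omega T p -> 0 <= a p) ->
  2 < gamma -> 0 < c0 -> 0 < c1 -> 0 < C -> 0 < theta ->
  (forall x t, cylinder Omega T (x, t) -> a (x, t) <= c0 * bdist Omega x `^ gamma) ->
  (forall x t, cylinder Omega T (x, t) ->
    enorm (grad a (x, t)) <= c1 * bdist Omega x `^ (gamma - 1)) ->
  C21 Omega T u -> {within closed_cylinder Omega T, continuous u} ->
  (forall p, cylinder Omega T p -> dt T u p = divergence (fun q => a q *: grad u q) p) ->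
  0 <= t0 -> t0 < tau -> tau <= T -> tau <= t0 + delta / 2 -> 0 < delta ->
  (forall x, Omega x -> u (x, t0) = 0) ->
  2 * (- m * (2 * c1 + c0 * (4 * (1 - m) + 2 * n%:R))) <=
    delta^-1 * (n.+1%:R * (2 * L) ^+ 2) `^ m ->
  theta + 1 <= al / delta * 10 `^ m ->
  0 < eps -> (forall j, boundary Omega (y j)) ->
  (forall z, boundary Omega z -> exists j, sqdist z (y j) <= eps ^+ 2) ->
  (\int[@lebesgue_measure R]_(t in `[0%R, T])
    integral_rV (inner_set Omega eps) (fun x => `|u (x, t)|%:E)
      <= (C * expR (theta * X))%:E)%E ->
  let phi x := test_fun Omega y m al S K x tau in
  [/\ integral_Rn (fun x => smooth_abs (u (x, tau)) * phi x) <=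
      6 * (4 * c0 * (2 * al / delta) ^+ 2 * m ^+ 2) * C * (X * expR (- X)),
    continuous (fun x => smooth_abs (u (x, tau)) * phi x) &
    supp_in L (fun x => smooth_abs (u (x, tau)) * phi x)].
Proof.
move=> oO OL L0 aC a0 gam2 c00 c10 C0 th0 ab gb uC uc ueq t00 t0tau tauT taud d0 ui dB dth e0 By net grow phi.
have m0 : m < 0 by rewrite /m; lra.
have al0 : 0 < al by rewrite /al invr_gt0; apply: mulr_gt0; [exact: mulr_gt0|rewrite exprn_even_gt0//= lt_eqF].
have tS : tau < S by rewrite /S; lra.
have St t : t0 <= t <= tau -> delta / 2 <= S - t <= delta by rewrite /S; lra.
have yO x j : Omega x -> 0 < sqdist x (y j) by move=> Ox; exact: open_boundary (By j).
have dq x j : Omega x -> bdist Omega x ^+ 2 <= sqdist x (y j).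
  by move=> Ox; rewrite -enorm_sqd ler_pXn2r ?nnegrE ?enorm_ge0 ?bdist_ge0// bdist_le.
have XE : X = (eps ^+ 2) `^ m by rewrite powR_sqr ?(ltW e0)// /X /m; congr powR; field.
have X0 : 0 < X by rewrite powR_gt0.
have Kpos : 0 < K by exact: expR_gt0.
have Kb x t : Omega x -> t0 <= t <= tau -> bdist Omega x < 2 * eps -> K <= barrier y m al S x t.
  move=> Ox tt xe.
  have [z Bz xz] : exists2 z, boundary Omega z & enorm (x - z) < 2 * eps.
    apply: contrapT => nz; move: xe; apply/negP; rewrite -leNgt; apply: lb_le_inf.
      by exists (enorm (x - y j0)), (y j0).
    move=> _ [z Bz <-]; rewrite leNgt; apply/negP => h; apply: nz; by exists z.
  have [j zj] := net z Bz.
  apply: le_trans (barrier_ge_term _ _ _ _ j _ _); rewrite /K /barrier_term ler_expR.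
  have hq : sqdist x (y j) <= 10 * eps ^+ 2.
    apply: le_trans (sqdist_split x z (y j)) _; rewrite -enorm_sqd.
    have : enorm (x - z) ^+ 2 <= (2 * eps) ^+ 2.
      by rewrite ler_pXn2r ?nnegrE ?enorm_ge0 ?mulr_ge0 ?(ltW e0)// ltW.
    by rewrite exprMn; lra.
  have hp : 10 `^ m * X <= sqdist x (y j) `^ m.
    rewrite XE -powRM ?sqr_ge0//; apply: le_powR_neg => //; first exact: ltW.
    exact: yO.
  apply: le_trans (ler_wpM2r (ltW X0) dth) _.
  rewrite [leLHS](_ : _ = al / delta * (10 `^ m * X)); last by ring.
  have [s1 s2] : 0 < S - t /\ S - t <= delta by have := St t tt; lra.
  apply: ler_pM; last exact: hp.
  - by rewrite divr_ge0// ltW.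
  - by rewrite mulr_ge0 ?powR_ge0// ltW.
  - by rewrite ler_pM2l// lef_pV2 ?posrE.
pose G := 4 * c0 * (2 * al / delta) ^+ 2 * m ^+ 2 * X.
have G0 : 0 <= G.
  have h4 : 0 <= 4 * c0 by rewrite mulr_ge0// ltW.
  by apply: mulr_ge0 (ltW X0); apply: mulr_ge0 (sqr_ge0 _); apply: mulr_ge0 (sqr_ge0 _).
pose M := 6 / K * G.
have M0 : 0 <= M by rewrite /M mulr_ge0// divr_ge0// ltW.
have key x t : Omega x -> t0 < t < tau -> 2 * eps <= bdist Omega x ->
    test_fun_t Omega y m al S K x t + \sum_i (dx i a (x, t) * test_fun_x Omega y m al S K i x t +
    a (x, t) * test_fun_xx Omega y m al S K i x t) <= M.
  move=> Ox tt xe; have tc : t0 <= t <= tau by lra.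
  have cyl : cylinder Omega T (x, t) by split => //=; lra.
  have [s1 s2 s3] : [/\ 0 < S - t, S - t <= delta & delta / 2 <= S - t] by have := St t tc; split; lra.
  have tSt : t < S by lra.
  have b0 : 0 <= bdist Omega x by exact: bdist_ge0.
  have ac j : a (x, t) <= c0 * sqdist x (y j) `^ (1 - m).
    apply: le_trans (ab x t cyl) _; rewrite ler_pM2l//.
    rewrite (_ : gamma = 2 * (1 - m)); last by rewrite /m; field.
    rewrite -powR_sqr//; apply: ge0_ler_powR; rewrite ?nnegrE ?sqr_ge0 ?sqdist_ge0 ?dq//; lra.
  have gc j : \sum_i dx i a (x, t) ^+ 2 <= (c1 * sqdist x (y j) `^ (2^-1 - m)) ^+ 2.
    have -> : \sum_i dx i a (x, t) ^+ 2 = enorm (grad a (x, t)) ^+ 2.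
      by rewrite enorm_sqr; apply: eq_bigr => i _; rewrite mxE.
    have c0' : 0 <= c1 * sqdist x (y j) `^ (2^-1 - m) by rewrite mulr_ge0 ?powR_ge0 ?(ltW c10).
    rewrite ler_pXn2r ?nnegrE ?enorm_ge0//; apply: le_trans (gb x t cyl) _; rewrite ler_pM2l//.
    rewrite (_ : gamma - 1 = 2 * (2^-1 - m)); last by rewrite /m; field.
    rewrite -powR_sqr//; apply: ge0_ler_powR; rewrite ?nnegrE ?sqr_ge0 ?sqdist_ge0 ?dq//; lra.
  have sB j : 2 * (- m * (2 * c1 + c0 * (4 * (1 - m) + 2 * n%:R))) <=
     (S - t)^-1 * sqdist x (y j) `^ m.
    apply: le_trans dB _; apply: ler_pM; rewrite ?powR_ge0 ?invr_ge0 ?(ltW d0)//.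
      by rewrite lef_pV2 ?posrE.
    apply: le_powR_neg; [exact: ltW|exact: yO|apply: sqdist_bound; first exact: OL].
    exact: boundary_bound OL _ (By j).
  have al8 : 8 * al * c0 * m ^+ 2 <= 1.
    have alN : al != 0 by rewrite gt_eqF.
    have -> : 8 * al * c0 * m ^+ 2 = al * (8 * c0 * m ^+ 2) by ring.
    by rewrite mulVf// -invr_eq0.
  have sq j : sqdist x (y j) `^ m <= X.
    rewrite XE; apply: le_powR_neg; [exact: ltW|by rewrite exprn_gt0|].
    apply: le_trans (dq x j Ox); rewrite ler_pXn2r ?nnegrE ?(ltW e0)//; lra.
  have xj j : 0 < sqdist x (y j) by exact: yO.
  have h1 := barrier_supersol y m al S x t j0 c0 (a (x, t)) xj tSt m0 al0 (ltW c00) (a0 _ cyl) ac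
    (fun i => dx i a (x, t)) c1 (ltW c10) gc al8 sB.
  have h2 := barrier_grad_le y m al S x t j0 c0 (a (x, t)) xj tSt (a0 _ cyl) ac X sq.
  apply: (test_fun_supersol Omega y m al S K j0 Kpos x t (a (x, t)) G _ Ox G0 h1).
  rewrite mulr_ge0 ?(a0 _ cyl) ?sumr_ge0//=; last by move=> i _; exact: sqr_ge0.
  apply: le_trans h2 _; rewrite ler_wpM2r ?sqr_ge0// /G ler_wpM2r ?(ltW X0)//.
  rewrite ler_wpM2r ?sqr_ge0// ler_wpM2l ?mulr_ge0 ?(ltW c00)//.
  have ad : 0 <= al / (S - t) by rewrite divr_ge0// ltW.
  have ad2 : 0 <= 2 * al / delta by rewrite divr_ge0 ?mulr_ge0// ltW.
  rewrite ler_pXn2r ?nnegrE// ler_pdivrMr// mulrAC ler_pdivlMr//.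
  by rewrite [X in _ <= X](_ : _ = al * (2 * (S - t))) ?ler_pM2l//; [lra|ring].
have [cf sf] := step_cont Omega T u y m al S K t0 tau eps L j0 oO OL uc t00 t0tau tauT tS e0 Kpos By Kb.
split=> //.
have st := step_energy Omega T a u y m al S K t0 tau eps M L j0 oO OL aC a0 uC uc ueq t00 t0tau
  tauT tS e0 Kpos M0 By Kb key.
apply: le_trans st _.
rewrite (_ : (fun x => smooth_abs (u (x, t0)) * _) = fun=> 0); last first.
  apply/funext => x; have [Ox|nOx] := pselect (Omega x); first by rewrite ui// smooth_abs0 mul0r.
  by rewrite /test_fun ext0F// mulr0.
rewrite integral_Rn0 add0r.
have := ramp_integral_le Omega T u t0 tau eps L _ e0 t00 tauT _ grow => /(_ _)/(ler_wpM2l M0).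
move=> h; apply: le_trans (h _) _.
  by move=> t tt; exact: (ramp_cont Omega T u t0 tau eps L oO OL uc t00 t0tau tauT e0 t tt).
rewrite /M /G /K (_ : expR ((theta + 1) * X) = expR (theta * X) * expR X); last first.
  by rewrite -expRD; congr expR; ring.
rewrite expRN le_eqVlt; apply/orP; left; apply/eqP.
have k1 := expR_gt0 (theta * X); have k2 := expR_gt0 X.
move: (expR (theta * X)) (expR X) k1 k2 => k1 k2 k10 k20.
by field; rewrite !gt_eqF.
Qed.

End decay.

(** * Uniqueness on a short time step *)

Lemma test_fun_lower {R : realType} {n : nat} {J : finType} (Omega : set 'rV[R]_n)
    (y : J -> 'rV[R]_n) (m al S K W : R) (j0 : J) x t :
  Omega x -> barrier y m al S x t <= W -> 2 * W <= K ->
  (8 * W)^-1 <= test_fun Omega y m al S K x t.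
Proof.
move=> Ox bW WK; have b0 := barrier_gt0 y m al S x t j0.
have W0 : 0 < W := lt_le_trans b0 bW.
have K0 : 0 < K by lra.
rewrite /test_fun ext0T//; apply: le_trans (profile_lower _ K0 _ b0 _); last by lra.
by rewrite lef_pV2 ?posrE ?mulr_gt0// ler_pM2l.
Qed.

Lemma barrier_le {R : realType} {n : nat} {J : finType} (y : J -> 'rV[R]_n) (m al S B : R) x t :
  (forall j, al / (S - t) * sqdist x (y j) `^ m <= B) ->
  barrier y m al S x t <= #|J|%:R * expR B.
Proof.
move=> h; apply: (@le_trans _ _ (\sum_(j : J) expR B)); last by rewrite sumr_const mulr_natl.
by apply: ler_sum => j _; rewrite ler_expR.
Qed.

(** Suppose that u(tau) is nonzero at [x], hence on a small box around [x]. There the test function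
    is at least a constant divided by the number N of points of the net, so that
    [energy_decay] bounds 1/N from above by a multiple of X exp (- X). As N is at most a power
    of X, this fails for a suitable choice of [eps]. *)
Lemma uniqueness_step {R : realType} {n : nat} (Omega : set 'rV[R]_n) (T : R)
    (a u : 'rV[R]_n * R -> R) (gamma c0 c1 C theta eps0 L delta t0 tau : R) :
  let m := 1 - gamma / 2 in let al := (8 * c0 * m ^+ 2)^-1 in
  open Omega -> (forall x, Omega x -> `|x| <= L) -> 0 < L -> boundary Omega !=set0 ->
  C10 Omega T a -> (forall p, cylinder Omega T p -> 0 <= a p) ->
  2 < gamma -> 0 < c0 -> 0 < c1 -> 0 < C -> 0 < theta -> 0 < eps0 ->
  (forall x t, cylinder Omega T (x, t) -> a (x, t) <= c0 * bdist Omega x `^ gamma) ->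
  (forall x t, cylinder Omega T (x, t) ->
    enorm (grad a (x, t)) <= c1 * bdist Omega x `^ (gamma - 1)) ->
  C21 Omega T u -> {within closed_cylinder Omega T, continuous u} ->
  (forall p, cylinder Omega T p -> dt T u p = divergence (fun q => a q *: grad u q) p) ->
  (forall eps, 0 < eps < eps0 ->
    (\int[@lebesgue_measure R]_(t in `[0%R, T])
      integral_rV (inner_set Omega eps) (fun x => `|u (x, t)|%:E)
        <= (C * expR (theta * eps `^ (- gamma + 2)))%:E)%E) ->
  0 < delta ->
  2 * (- m * (2 * c1 + c0 * (4 * (1 - m) + 2 * n%:R))) <=
    delta^-1 * (n.+1%:R * (2 * L) ^+ 2) `^ m ->
  theta + 1 <= al / delta * 10 `^ m ->
  0 <= t0 -> t0 < tau -> tau <= T -> tau <= t0 + delta / 2 ->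
  (forall x, Omega x -> u (x, t0) = 0) -> forall x, Omega x -> u (x, tau) = 0.
Proof.
move=> m al oO OL L0 B0 aC a0 gam2 c00 c10 C0 th0 e00 ab gb uC uc ueq grow d0 dB dth t00 t0tau tauT taud ui x Ox.
apply: contrapT => /eqP ux.
have m0 : m < 0 by rewrite /m; lra.
have al0 : 0 < al.
  by rewrite /al invr_gt0; apply: mulr_gt0; [exact: mulr_gt0|rewrite exprn_even_gt0//= lt_eqF].
pose b := smooth_abs (u (x, tau)) / 2; have s0 := smooth_abs_gt0 _ ux.
have b0 : 0 < b by rewrite /b divr_gt0.
pose d := bdist Omega x / 2; have bx := bdist_gt0 Omega x oO B0 Ox.
have dd0 : 0 < d by rewrite /d divr_gt0.
have cs : {for x, continuous (fun z => smooth_abs (u (z, tau)))}.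
  apply: (cont_comp smooth_abs (fun z => u (z, tau))); first exact: smooth_abs_continuous.
  have [[cu _] _ _ _] := uC.
  by apply: (within_slice Omega T u oO x tau cu Ox); lra.
have [r r0 hr] : exists2 r, 0 < r & forall z, box x r z ->
    [/\ Omega z, b <= smooth_abs (u (z, tau)) & d <= bdist Omega z].
  have [e1 e10 h1] := (continuousP_norm _ _ _ _).1 cs b b0.
  have [e2 e20 h2] := (continuousP_norm _ _ _ _).1 (bdist_continuous Omega x) d dd0.
  have /nbhs_ballP[e3 /= e30 h3] : nbhs x Omega by exact: open_nbhs_nbhs.
  pose r := Num.min e1 (Num.min e2 e3) / 2.
  have m_gt0 : 0 < Num.min e1 (Num.min e2 e3) by rewrite !lt_min e10 e20 e30.
  exists r; first by rewrite divr_gt0.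
  move=> z; rewrite boxE ?divr_ge0 ?(ltW m_gt0)//= => zx.
  have zlt : `|z - x| < Num.min e1 (Num.min e2 e3) by move: zx; rewrite /r; lra.
  move: zlt; rewrite !lt_min => /and3P[z1 z2 z3].
  split; first by apply: h3; rewrite -ball_normE /= distrC.
    by have := h1 z z1; rewrite ltr_distl /b => /andP[]; lra.
  by have := h2 z z2; rewrite ltr_distl /d => /andP[]; lra.
pose W1 := expR (2 * al / delta * (d ^+ 2) `^ m); have W10 : 0 < W1 := expR_gt0 _.
pose A1 := 6 * (4 * c0 * (2 * al / delta) ^+ 2 * m ^+ 2) * C.
have A10 : 0 <= A1.
  apply: mulr_ge0 (ltW C0); apply: mulr_ge0 => //; apply: mulr_ge0 (sqr_ge0 _).
  by apply: mulr_ge0 (sqr_ge0 _); rewrite mulr_ge0// ltW.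
pose Cn := (2 * L * n.+1%:R + 1) ^+ n.
have Cn0 : 0 <= Cn by rewrite exprn_ge0// addr_ge0// mulr_ge0// mulr_ge0// ltW.
pose v := b * (r *+ 2) ^+ n.
have v0 : 0 < v by rewrite mulr_gt0// exprn_gt0// mulrn_wgt0.
(* N is of the order of eps^(- n) = X^(n / (gamma - 2)), and gamma - 2 = - (2 m). *)
pose p := (Num.truncn (n%:R / (- (2 * m)))).+1.
have m2 : 0 < - (2 * m) by lra.
have pn : n%:R / (- (2 * m)) <= p%:R.
  have := @truncn_itv _ (n%:R / (- (2 * m))); rewrite divr_ge0 ?(ltW m2)// => /(_ isT).
  by move=> /andP[_ /ltW].
have A00 : 0 <= 2 * W1 * Cn by apply: mulr_ge0 Cn0; rewrite mulr_ge0// ltW.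
have [X1 X11 hX1] := expR_gt_pow (2 * W1 * Cn) p A00.
have A20 : 0 <= 8 * W1 * A1 * Cn / v.
  apply: divr_ge0 (ltW v0); apply: mulr_ge0 Cn0; apply: mulr_ge0 A10.
  by rewrite mulr_ge0// ltW.
have [X2 X21 hX2] := expR_gt_pow (8 * W1 * A1 * Cn / v) p.+1 A20.
(* X has to exceed the two thresholds for the exponential, and to be so large that
   eps = X^(1 / (2 m)) is below eps0 and 1. *)
pose e1 := Num.min eps0 1 / 2.
have e10 : 0 < e1 by rewrite divr_gt0// lt_min e00 ltr01.
pose X := Num.max X1 (Num.max X2 (e1 `^ (2 * m))).
have XX1 : X1 <= X by rewrite le_max lexx.
have XX2 : X2 <= X by rewrite !le_max lexx orbT.
have XX3 : e1 `^ (2 * m) <= X by rewrite !le_max lexx !orbT.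
have X1' : 1 <= X := le_trans X11 XX1.
have X0 : 0 < X := lt_le_trans ltr01 X1'.
pose eps := X `^ (2 * m)^-1.
have eps_gt0 : 0 < eps by rewrite powR_gt0.
have mN : 2 * m != 0 by rewrite lt_eqF//; lra.
have epsX : eps `^ (- gamma + 2) = X.
  rewrite (_ : - gamma + 2 = 2 * m); last by rewrite /m; field.
  by rewrite -powRrM mulVf// powRr1// ltW.
have epse : eps <= e1.
  have -> : e1 = (e1 `^ (2 * m)) `^ (2 * m)^-1 by rewrite -powRrM mulfV// powRr1// ltW.
  apply: le_powR_neg; [by rewrite invr_le0; lra|by rewrite powR_gt0|exact: XX3].
have me : Num.min eps0 1 <= eps0 /\ Num.min eps0 1 <= 1 by rewrite !ge_min !lexx orbT.
have e1E : Num.min eps0 1 = e1 * 2 by rewrite /e1 divfK.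
have [ee0 ee1] : eps < eps0 /\ eps <= 1 by move: me => []; rewrite e1E; split; lra.
have [k [y [kle [j0] By net]]] := boundary_net (boundary Omega) L eps B0
  (boundary_bound Omega L OL) (introT andP (conj eps_gt0 ee1)).
have g1 : 0 < eps < eps0 by rewrite eps_gt0.
have := energy_decay Omega T a u gamma c0 c1 C theta L delta t0 tau eps y j0 oO OL L0 aC a0
  gam2 c00 c10 C0 th0 ab gb uC uc ueq t00 t0tau tauT taud d0 ui dB dth eps_gt0 By net
  (grow eps g1).
rewrite -/m -/al epsX => -[up cf sf].
set K := expR _ in up cf sf.
pose N : R := #|{ffun 'I_n -> 'I_k}|%:R.
have N0 : 0 < N by rewrite ltr0n; apply/card_gt0P; exists j0.
have NX : N <= Cn * X ^+ p.
  rewrite /N card_ffun !card_ord natrX.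
  apply: (@le_trans _ _ (((2 * L * n.+1%:R + 1) / eps) ^+ n)).
    have q0 : 0 <= (2 * L * n.+1%:R + 1) / eps.
      by rewrite divr_ge0 ?(ltW eps_gt0)// addr_ge0// mulr_ge0// mulr_ge0// ltW.
    by apply: lerXn2r; rewrite ?nnegrE.
  rewrite exprMn ler_wpM2l// /eps -powRN -powR_mulrn ?powR_ge0// -powRrM -powR_mulrn ?(ltW X0)//.
  rewrite ler_powR// (_ : _ * _ = n%:R / (- (2 * m)))//; field.
  by rewrite lt_eqF.
have KX : expR X <= K.
  by rewrite ler_expR mulrDl mul1r lerDr mulr_ge0// ltW.
have W2 : 2 * (N * W1) <= K.
  apply: le_trans KX; apply: le_trans (ltW (hX1 X XX1)).
  rewrite (_ : 2 * (N * W1) = 2 * W1 * N); last by ring.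
  rewrite [leRHS](_ : _ = 2 * W1 * (Cn * X ^+ p)); last by ring.
  by rewrite ler_wpM2l// mulr_ge0// ltW.
have lo : b * (8 * (N * W1))^-1 * (r *+ 2) ^+ n <=
    A1 * (X * expR (- X)).
  apply: le_trans up; apply: (integral_Rn_ge_box L r _ x) => //.
  - move=> z; rewrite mulr_ge0 ?smooth_abs_ge0//; exact: (test_fun_ge0 Omega y m al _ K j0 (expR_gt0 _)).
  - exact: ltW.
  - by rewrite mulr_ge0 ?(ltW b0)// invr_ge0 mulr_ge0// mulr_ge0// ltW.
  move=> z /hr[Oz bz dz]; apply: ler_pM => //; first exact: ltW.
    by rewrite invr_ge0 mulr_ge0// mulr_ge0// ltW.
  apply: test_fun_lower => //; apply: barrier_le => j.
  have s1 : delta / 2 <= t0 + delta - tau by lra.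
  have s2 : 0 < t0 + delta - tau by lra.
  apply: ler_pM; [by rewrite divr_ge0// ltW|exact: powR_ge0| |].
    rewrite ler_pdivrMr// mulrAC ler_pdivlMr//.
    by rewrite [leRHS](_ : _ = al * (2 * (t0 + delta - tau))) ?ler_pM2l//; [lra|ring].
  apply: le_powR_neg; [exact: ltW|by rewrite exprn_gt0|].
  rewrite -enorm_sqd ler_pXn2r ?nnegrE ?enorm_ge0 ?(ltW dd0)//.
  exact: le_trans dz (bdist_le _ _ _ (By j)).
have := hX2 X XX2; apply/negP; rewrite -leNgt.
have eX := expR_gt0 X.
have lo2 : v * expR X <= 8 * W1 * A1 * N * X.
  move: lo; rewrite (_ : b * _ * _ = v / (8 * (N * W1))); last by rewrite /v; ring.
  rewrite ler_pdivrMr ?mulr_gt0// expRN => lo.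
  rewrite -ler_pdivlMr//; apply: le_trans lo _; rewrite le_eqVlt; apply/orP; left; apply/eqP.
  by field; rewrite gt_eqF.
rewrite -(ler_pM2l v0); apply: le_trans lo2 _.
rewrite (_ : v * _ = 8 * W1 * A1 * (Cn * X ^+ p) * X); last first.
  by rewrite [X ^+ p.+1]exprS; field; rewrite gt_eqF.
by rewrite ler_pM2r// ler_wpM2l// mulr_ge0// mulr_ge0// ltW.
Qed.

(** * Uniqueness *)

Theorem theorem2p1 (R : realType) (n : nat) (hn : (0 < n)%N)
    (Omega : set 'rV[R]_n) (T : R) (a u : 'rV[R]_n * R -> R)
    (gamma c0 c0' c1 C theta eps0 : R)
    (Omega_open : open Omega) (Omega_bounded : bounded_set Omega)
    (Omega_boundary : Ck_submanifold 3 n.-1 (boundary Omega))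
    (T_gt0 : 0 < T)
    (a_C10 : C10 Omega T a)
    (a_ge0 : forall p, cylinder Omega T p -> 0 <= a p)
    (a_neq0 : exists p, cylinder Omega T p /\ a p != 0)
    (gamma_gt2 : 2 < gamma)
    (c0'_gt0 : 0 < c0') (c0'_lt_c0 : c0' < c0) (c1_gt0 : 0 < c1)
    (a_bounds : forall x t, cylinder Omega T (x, t) ->
       c0' * bdist Omega x `^ gamma <= a (x, t) <= c0 * bdist Omega x `^ gamma)
    (grad_a_bound : forall x t, cylinder Omega T (x, t) ->
       enorm (grad a (x, t)) <= c1 * bdist Omega x `^ (gamma - 1))
    (u_C21 : C21 Omega T u)
    (u_cont : {within closed_cylinder Omega T, continuous u})
    (u_eq : forall p, cylinder Omega T p ->
       dt T u p = divergence (fun q => a q *: grad u q) p)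
    (u_init : forall x, Omega x -> u (x, 0) = 0)
    (C_gt0 : 0 < C) (theta_gt0 : 0 < theta) (eps0_gt0 : 0 < eps0)
    (u_growth : forall eps, 0 < eps < eps0 ->
       (\int[@lebesgue_measure R]_(t in `[0%R, T])
          integral_rV (inner_set Omega eps) (fun x => `|u (x, t)|%:E)
        <= (C * expR (theta * eps `^ (- gamma + 2)))%:E)%E) :
  forall p, cylinder Omega T p -> u p = 0.
Proof.
have c0_gt0 : 0 < c0 by exact: lt_trans c0'_lt_c0.
have [L L_gt0 OL] : exists2 L, 0 < L & forall x, Omega x -> `|x| <= L.
  have [M [_ hM]] := Omega_bounded; exists (Num.max M 0 + 1).
    by rewrite ltr_wpDl// le_max lexx orbT.
  by apply: hM; rewrite ltr_pwDr// le_max lexx.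
have upper x t : cylinder Omega T (x, t) -> a (x, t) <= c0 * bdist Omega x `^ gamma.
  by move=> /a_bounds/andP[].
(* Without boundary points the distance would be 0 by convention, and [a] with it. *)
have B0 : boundary Omega !=set0.
  apply: contrapT => nB; have [[x t] [cyl /eqP]] := a_neq0; apply.
  apply: le_anti; rewrite a_ge0// andbT.
  have := upper x t cyl; rewrite bdist_empty// powR0 ?mulr0//.
  by rewrite gt_eqF//; lra.
pose m := 1 - gamma / 2; pose al := (8 * c0 * m ^+ 2)^-1.
have m0 : m < 0 by rewrite /m; lra.
have al0 : 0 < al.
  by rewrite /al invr_gt0; apply: mulr_gt0; [exact: mulr_gt0|rewrite exprn_even_gt0//= lt_eqF].
pose B := 2 * (- m * (2 * c1 + c0 * (4 * (1 - m) + 2 * n%:R))).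
have B_gt0 : 0 < B.
  rewrite mulr_gt0// mulr_gt0 ?oppr_gt0// ltr_wpDr ?mulr_gt0//.
  apply: mulr_ge0; first exact: ltW.
  by rewrite addr_ge0 ?mulr_ge0//; lra.
pose D := (n.+1%:R * (2 * L) ^+ 2) `^ m.
have D_gt0 : 0 < D by rewrite powR_gt0// mulr_gt0// exprn_gt0// mulr_gt0.
have p10 : 0 < 10 `^ m :> R by rewrite powR_gt0.
(* The largest time step compatible with the two conditions of [uniqueness_step]. *)
pose delta := Num.min (D / B) (al * 10 `^ m / (theta + 1)).
have th1 : 0 < theta + 1 by lra.
have delta_gt0 : 0 < delta by rewrite lt_min !divr_gt0// mulr_gt0.
have dB : B <= delta^-1 * D.
  rewrite mulrC ler_pdivlMr// mulrC -ler_pdivlMr//.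
  by rewrite ge_min lexx.
have dth : theta + 1 <= al / delta * 10 `^ m.
  rewrite mulrAC ler_pdivlMr// mulrC -ler_pdivlMr//.
  by rewrite ge_min lexx orbT.
have step := uniqueness_step Omega T a u gamma c0 c1 C theta eps0 L delta _ _
  Omega_open OL L_gt0 B0 a_C10 a_ge0 gamma_gt2 c0_gt0 c1_gt0 C_gt0 theta_gt0 eps0_gt0
  upper grad_a_bound u_C21 u_cont u_eq u_growth delta_gt0 dB dth.
have main k : forall t, 0 <= t <= T -> t <= k%:R * (delta / 2) ->
    forall x, Omega x -> u (x, t) = 0.
  elim: k => [|k IH] t /andP[t0 tT] tk x Ox.
    by have -> : t = 0 by [apply: le_anti; rewrite t0 andbT; rewrite mul0r in tk|]; exact: u_init.
  have [tle|tgt] := leP t (k%:R * (delta / 2)); first by apply: IH => //; rewrite t0.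
  have k0 : 0 <= k%:R * (delta / 2) by rewrite mulr_ge0// divr_ge0// ltW.
  apply: (step (k%:R * (delta / 2)) t) => //.
    by move: tk; rewrite -natr1 mulrDl mul1r.
  by apply: IH => //; rewrite k0 (le_trans (ltW tgt)).
move=> [x t] [/= Ox /andP[t0 tT]].
apply: (main (Num.truncn (t / (delta / 2))).+1) => //; first by rewrite (ltW t0).
have d2 : 0 < delta / 2 by rewrite divr_gt0.
rewrite -ler_pdivrMr//; have := @truncn_itv _ (t / (delta / 2)).
by rewrite divr_ge0 ?(ltW t0) ?(ltW d2)// => /(_ isT)/andP[_ /ltW].
Qed.
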